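(* There is a constant $c\geq 0$ such that the following holds. Let $P$ be a fixed pattern graph with $k$ vertices and pathwidth $p$. Then there exists an algorithm that takes as input an $n$-vertex host graph $H$ and counts the number of subgraphs of $H$ that are isomorphic to $P$ in time $$O\bigl(n^{(\frac12-\tau)k+2p+c}+n^{k/3+3p+c}\bigr),$$ where $c$ is independent of the constants $k,p,\tau$, and $$\tau=\begin{cases}\dfrac{(3-\omega)(1-\alpha)}{36-6(1+\omega)(1+\alpha)} & \text{if }\alpha\leq 1/2,\\[2mm] \dfrac{1}{18} & \text{if }\alpha\geq 1/2.\end{cases}$$
   Context: $P$ is fixed, so $k$ and $p$ are constants independent of $n$ (the constant hidden in $O(\cdot)$ may depend on $P$). $\omega$ is the limiting exponent of square matrix multiplication, $2\leq\omega<2.3728639$. $\alpha$ is the limiting exponent such that multiplying an $N\times N^\alpha$ matrix with an $N^\alpha\times N$ matrix takes $N^{2+o(1)}$ arithmetic operations, $0.3<\alpha\leq 3-\omega$; one has $\alpha=1$ if and only if $\omega=2$. Convention used in all running times: the product of an $N\times M$ matrix and an $M\times N$ matrix can be computed using (M1) $O(N^{2-\alpha\beta}M^\beta+N^2)$ arithmetic operations when $M\leq N$, where $\beta=(\omega-2)/(1-\alpha)$ (read $\beta=0$ if $\alpha=1$), and (M2) $O(N^{\omega-1}M)$ arithmetic operations when $M\geq N$. *)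

(* Defs.v *)
From mathcomp Require Import all_boot all_order all_algebra.
From mathcomp Require Import boolp classical_sets reals topology sequences exp.

Set Implicit Arguments.
Unset Strict Implicit.
Unset Printing Implicit Defensive.

Import Order.TTheory GRing.Theory Num.Theory.

Local Open Scope ring_scope.

(** * Simple graphs, subgraphs, pathwidth *)

Record sgraph (V : finType) := SGraph {
  adj :> rel V;
  adj_sym : symmetric adj;
  adj_irrefl : irreflexive adj }.

Definition edges (V : finType) (G : sgraph V) : {set {set V}} :=
  [set [set e.1; e.2] | e : V * V & G e.1 e.2].

(* A pair X = (S, F) is the graph with vertex set S and edge set F. *)
Definition is_subgraph (V : finType) (H : sgraph V)
    (X : {set V} * {set {set V}}) : bool :=
  (X.2 \subset edges H) && [forall e in X.2, e \subset X.1].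

Definition isomorphic_to (V U : finType) (P : sgraph U)
    (X : {set V} * {set {set V}}) : bool :=
  [exists f : {ffun U -> V},
    [&& injectiveb f, [set f u | u : U] == X.1
      & [forall u, forall v, P u v == ([set f u; f v] \in X.2)]]].

Definition count_subgraphs (U V : finType) (P : sgraph U) (H : sgraph V) : nat :=
  #|[set X : {set V} * {set {set V}} | is_subgraph H X && isomorphic_to P X]|.

Definition path_decomposition (V : finType) (G : sgraph V)
    (bags : seq {set V}) : Prop :=
  [/\ forall v, exists2 X, X \in bags & v \in X,
      forall u v, G u v -> exists2 X, X \in bags & (u \in X) && (v \in X)
    & forall a b c, (a <= b)%N -> (b <= c)%N -> (c < size bags)%N ->
        nth finset.set0 bags a :&: nth finset.set0 bags c \subset nth finset.set0 bags b].

Definition pd_width (V : finType) (bags : seq {set V}) : nat :=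
  (\max_(X <- bags) #|X|).-1.

(* The truncated predecessor gives the graph without vertices pathwidth 0. *)
Definition is_pathwidth (V : finType) (G : sgraph V) (p : nat) : Prop :=
  (exists2 bags, path_decomposition G bags & pd_width bags = p) /\
  (forall bags, path_decomposition G bags -> (p <= pd_width bags)%N).

(** * The exponents of matrix multiplication, over the field of rationals *)

(* Straight-line programs. The k-th computed value is appended to the list of
   the inputs and of the values computed so far, and operands are positions in
   this list. Divisions do not affect the exponents and are left out. *)
Inductive slp_instr :=
  | SLConst of rat
  | SLAdd of nat & nat
  | SLSub of nat & nat
  | SLMul of nat & nat.

Definition slp_step (vs : seq rat) (o : slp_instr) : seq rat :=
  rcons vs match o with
           | SLConst q => q
           | SLAdd i j => vs`_i + vs`_j
           | SLSub i j => vs`_i - vs`_j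
           | SLMul i j => vs`_i * vs`_j
           end.

Definition slp_run (pr : seq slp_instr) (inputs : seq rat) : seq rat :=
  foldl slp_step inputs pr.

Definition mx_entries (m n : nat) (A : 'M[rat]_(m, n)) : seq rat :=
  [seq A i j | i <- enum 'I_m, j <- enum 'I_n].

Definition slp_mulmx (N M K : nat) (pr : seq slp_instr) : Prop :=
  exists out : 'I_N -> 'I_K -> nat,
    forall (A : 'M[rat]_(N, M)) (B : 'M[rat]_(M, K)) i j,
      (slp_run pr (mx_entries A ++ mx_entries B))`_(out i j) = (A *m B) i j.

(* The product of an N x (m N) matrix and an (m N) x N matrix takes O(N^e)
   arithmetic operations. *)
Definition mulmx_ops (R : realType) (m : nat -> nat) (e : R) : Prop :=
  exists C : R, forall N, (0 < N)%N -> exists2 pr : seq slp_instr,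
    slp_mulmx N (m N) N pr & (size pr)%:R <= C * N%:R `^ e.

Definition omega (R : realType) : R :=
  inf [set e : R | mulmx_ops id e]%classic.

Definition alpha (R : realType) : R :=
  sup [set a : R | 0 <= a /\ forall eps : R, 0 < eps ->
        mulmx_ops (fun N => Num.truncn (N%:R `^ a)) (2 + eps)]%classic.

Definition beta (R : realType) : R :=
  if alpha R == 1 then 0 else (omega R - 2) / (1 - alpha R).

Definition tau (R : realType) : R :=
  if alpha R <= 1 / 2
  then (3 - omega R) * (1 - alpha R) / (36 - 6 * (1 + omega R) * (1 + alpha R))
  else 1 / 18.

(** * Algorithms: a word RAM *)

(* The memory consists of registers and of arrays with statically known names.
   A program uses finitely many registers and array names. *)
Record state := State {
  reg : nat -> int;
  arr : nat -> nat -> int }.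

Definition set_reg (s : state) (r : nat) (v : int) : state :=
  State (fun r' => if r' == r then v else reg s r') (arr s).

Definition set_arr (s : state) (a i : nat) (v : int) : state :=
  State (reg s)
    (fun a' i' => if (a' == a) && (i' == i) then v else arr s a' i').

Inductive binop := OAdd | OSub | OMul | ODiv.

Definition eval_op (o : binop) (x y : int) : int :=
  match o with
  | OAdd => x + y
  | OSub => x - y
  | OMul => x * y
  | ODiv => (x %/ y)%Z
  end.

Inductive cmd :=
  | Skip
  | Const of nat & int               (* reg r := z *)
  | Op of binop & nat & nat & nat    (* reg r := reg x o reg y *)
  | ArrGet of nat & nat & nat          (* reg r := arr a [reg x] *)
  | ArrSet of nat & nat & nat         (* arr a [reg x] := reg y *)
  | Seq of cmd & cmd
  | IfPos of nat & cmd & cmd         (* branch on 0 < reg r *)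
  | WhilePos of nat & cmd.           (* loop while 0 < reg r *)

(* [exec W c s t s']: on a machine whose words hold the integers of absolute
   value at most W, the program c started in s halts in s' after t unit-cost
   steps. A run that computes a value not fitting in a word, or that uses a
   negative index, is stuck. *)
Inductive exec (W : nat) : cmd -> state -> nat -> state -> Prop :=
  | exec_skip s : exec W Skip s 1 s
  | exec_const s r z : (`|z| <= W)%N ->
      exec W (Const r z) s 1 (set_reg s r z)
  | exec_op s o r x y :
      (`|eval_op o (reg s x) (reg s y)| <= W)%N ->
      exec W (Op o r x y) s 1 (set_reg s r (eval_op o (reg s x) (reg s y)))
  | exec_get s r a x (i : nat) : reg s x = i ->
      (`|arr s a i| <= W)%N ->
      exec W (ArrGet r a x) s 1 (set_reg s r (arr s a i))
  | exec_set s a x y (i : nat) : reg s x = i ->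
      (`|reg s y| <= W)%N ->
      exec W (ArrSet a x y) s 1 (set_arr s a i (reg s y))
  | exec_seq c1 c2 s1 s2 s3 t1 t2 :
      exec W c1 s1 t1 s2 -> exec W c2 s2 t2 s3 ->
      exec W (Seq c1 c2) s1 (t1 + t2) s3
  | exec_if_pos r c1 c2 s s' t : 0 < reg s r ->
      exec W c1 s t s' -> exec W (IfPos r c1 c2) s t.+1 s'
  | exec_if_npos r c1 c2 s s' t : reg s r <= 0 ->
      exec W c2 s t s' -> exec W (IfPos r c1 c2) s t.+1 s'
  | exec_while_done r c s : reg s r <= 0 -> exec W (WhilePos r c) s 1 s
  | exec_while_step r c s1 s2 s3 t1 t2 : 0 < reg s1 r ->
      exec W c s1 t1 s2 -> exec W (WhilePos r c) s2 t2 s3 ->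
      exec W (WhilePos r c) s1 (t1 + t2).+1 s3.

Definition fits (W : nat) (s : state) : Prop :=
  (forall r, `|reg s r| <= W)%N /\ (forall a i, `|arr s a i| <= W)%N.

(* [solves c L d pre post bnd]: on every machine with words of at least
   d * log2 L bits, and whatever the contents of the memory besides the input
   described by pre, the program c halts with an output described by post
   within a number of steps satisfying bnd. *)
Definition solves (c : cmd) (L d : nat) (pre post : state -> Prop)
    (bnd : nat -> Prop) : Prop :=
  forall W s, (L ^ d <= W)%N -> fits W s -> pre s ->
    exists t s', [/\ exec W c s t s', post s' & bnd t].

(* Matrices are stored in row-major order. *)
Definition stores_mx (s : state) (a m n : nat) (A : 'M[int]_(m, n)) : Prop :=
  forall (i : 'I_m) (j : 'I_n), arr s a (i * n + j)%N = A i j.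

(* The number of steps depends on N and M only; the size of the entries only
   affects the word length. *)
Definition ram_mulmx (c : cmd) (d N M : nat) (bnd : nat -> Prop) : Prop :=
  forall (m : nat) (A : 'M[int]_(N, M)) (B : 'M[int]_(M, N)),
    (forall i j, `|A i j| <= m)%N -> (forall i j, `|B i j| <= m)%N ->
    solves c (N + M + m + 2)%N d
      (fun s => [/\ reg s 0 = N, reg s 1 = M, stores_mx s 0 A & stores_mx s 1 B])
      (fun s => stores_mx s 2 (A *m B))
      bnd.

Definition mulmx_M1 (R : realType) : Prop :=
  exists (c : cmd) (d : nat) (C : R), forall N M : nat,
    (0 < M)%N -> (M <= N)%N ->
    ram_mulmx c d N M (fun t =>
      t%:R <= C * (N%:R `^ (2 - alpha R * beta R) * M%:R `^ beta R + N%:R ^+ 2)).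

Definition mulmx_M2 (R : realType) : Prop :=
  exists (c : cmd) (d : nat) (C : R), forall N M : nat,
    (0 < N)%N -> (N <= M)%N ->
    ram_mulmx c d N M (fun t =>
      t%:R <= C * (N%:R `^ (omega R - 1) * M%:R)).

Definition stores_graph (s : state) (n : nat) (H : sgraph 'I_n) : Prop :=
  reg s 0 = n /\
  forall i j : 'I_n, arr s 0 (i * n + j)%N = (H i j : nat).

(* The program c, with words of O(log n) bits, counts the subgraphs isomorphic
   to P of every n-vertex graph in at most T n steps. *)
Definition counts_in_time (k : nat) (P : sgraph 'I_k) (c : cmd)
    (T : nat -> nat) : Prop :=
  exists d : nat, forall (n : nat) (H : sgraph 'I_n),
    solves c (n + 2)%N d
      (fun s => stores_graph s H)
      (fun s => reg s 0 = count_subgraphs P H)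
      (fun t => (t <= T n)%N).

(* Main.v *)
(** Proof idea. Expanding the product over all pairs u <> v of
    [1 - [f u = f v]] writes the number of embeddings of P into H as a signed
    sum, over quotients q of the vertex set of P, of the number of
    homomorphisms that are constant on the classes of q; the number of copies is
    the number of embeddings divided by the number of automorphisms of P.

    Two bags of a path decomposition cut P into three parts of at most k/3
    vertices, with at most 2p+2 separating vertices and no edges between
    different parts. Fix q. A class that meets no separator meets one, two or
    three of the parts; let a, b, c and t be the numbers of classes that meet
    exactly the parts {1,2}, {1,3}, {2,3} and all three parts. The number of
    extensions to part i is tabulated by brute force in time n^(k/3+2p+O(1)).
    What remains is, for all values on the separators and on the t classes, a
    sum of products f1(x,y) f2(x,z) f3(y,z) with x, y, z ranging over n^a, n^b
    and n^c values. With m = min(a,b,c) it is a sequence of products of square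
    matrices of order n^m, in total n^(2p+O(1)) n^(t+a+b+c-3m+m omega) steps.
    As t+a+b, t+a+c and t+b+c are at most k/3 and omega < 8/3, the exponent is
    at most 4k/9+2p+O(1), and tau <= 1/18. *)

Require Import Defs.
From mathcomp Require Import all_boot all_order all_algebra.
From mathcomp Require Import perm zify ring lra.

Set Implicit Arguments.
Unset Strict Implicit.
Unset Printing Implicit Defensive.

Import Order.TTheory GRing.Theory Num.Theory.

Local Open Scope ring_scope.

(** * Sums over assignments of pattern vertices *)

(** The extreme case of the exponent estimate is a = b = c = k/6 and t = 0. The matrices then have
    order n^(k/6), a product costs n^(omega k/6), and omega = 8/3 is the value at which this becomes
    n^(4k/9), where 4/9 = 1/2 - 1/18. The additive constant of the theorem only has to absorb the 2
    in 2p+2. The machine model adds three obstacles. The multiplication program is a black box,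
    known by its specification and by the registers and arrays that its text writes; whatever must
    survive a call is kept outside these. Words have O(log n) bits, so every index and every partial
    sum, not only the final results, needs a bound of the form n^O(k); constants x that depend on P
    alone are absorbed by x <= 2^x <= (n+2)^x. Finally, one program serves all n, so quotients,
    coefficients and cuts are computed from P alone and become part of the program text. *)

Lemma leq_absD (x y : int) : (`|(x + y)%R| <= `|x| + `|y|)%N.
Proof. by lia. Qed.

Section Environments.

Variables (V : finType) (n : nat).

Local Notation env := {ffun V -> 'I_n}.

Implicit Types (X Y L : seq V) (e f g : env).

Definition upd (e : env) (v : V) (i : 'I_n) : env :=
  [ffun u => if u == v then i else e u].

(** The order is reversed because the loops of the machine count down; the environments visited by
    nested loops then form exactly this list. *)
Fixpoint envs (L : seq V) (e : env) : seq env :=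
  if L is v :: L' then
    flatten [seq envs L' (upd e v i) | i <- rev (enum 'I_n)]
  else [:: e].

(** Here [X] lists the vertices on which [e] and [f] may differ. *)
Definition agree (X : seq V) (e f : env) : bool :=
  [forall v, (v \in X) || (f v == e v)].

Definition indep (X : seq V) (T : Type) (F : env -> T) : Prop :=
  forall e f, agree X e f -> F f = F e.

Definition sumL (L : seq V) (F : env -> int) (e : env) : int :=
  \sum_(f <- envs L e) F f.

(** The images of [L] read as digits in base [n]: the position of an assignment in a table, or its
    row or column number in a matrix. *)
Definition idx (L : seq V) (e : env) : nat :=
  foldl (fun a v => a * n + e v)%N 0%N L.

Lemma agreeP X e f : reflect (forall v, v \notin X -> f v = e v) (agree X e f).
Proof.
apply: (iffP forallP) => [A v vX|A v].
  by have := A v; rewrite (negPf vX) => /eqP.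
by case: (boolP (v \in X)) => //= /A ->.
Qed.

Lemma agree_refl X e : agree X e e.
Proof. exact/agreeP. Qed.

Lemma agree_trans X e f g : agree X e f -> agree X f g -> agree X e g.
Proof. by move=> /agreeP A /agreeP B; apply/agreeP => v vX; rewrite B ?A. Qed.

Lemma agree_sym X e f : agree X e f = agree X f e.
Proof. by apply: eq_forallb => v; rewrite eq_sym. Qed.

Lemma agree_sub X Y e f : {subset X <= Y} -> agree X e f -> agree Y e f.
Proof.
move=> sXY /agreeP A; apply/agreeP => v vY; apply: A.
by apply: contra vY => /sXY.
Qed.

Lemma agree_upd X e f v i : agree X e f -> agree X (upd e v i) (upd f v i).
Proof.
move=> /agreeP A; apply/agreeP => u uX; rewrite !ffunE.
by case: eqP => // _; exact: A.
Qed.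

Lemma agree_updr e v i : agree [:: v] e (upd e v i).
Proof. by apply/agreeP => u; rewrite inE ffunE => /negPf ->. Qed.

Lemma mem_envs L e f : f \in envs L e -> agree L e f.
Proof.
elim: L e => [|v L IH] e /=.
  by rewrite inE => /eqP ->; exact: agree_refl.
move=> /flatten_mapP [i _ /IH] /agreeP A; apply/agreeP => u.
by rewrite inE negb_or => /andP[uv uL]; rewrite A // ffunE (negPf uv).
Qed.

Lemma size_envs L e : size (envs L e) = (n ^ size L)%N.
Proof.
elim: L e => [|v L IH] e //=.
rewrite size_flatten /shape -map_comp (eq_map (g := fun=> (n ^ size L)%N)); last first.
  by move=> i /=; rewrite IH.
have -> : [seq (n ^ size L)%N | _ <- rev (enum 'I_n)] = nseq n (n ^ size L)%N.
  apply: (@eq_from_nth _ 0%N); first by rewrite size_map size_rev size_enum_ord size_nseq.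
  move=> i; rewrite size_map size_rev size_enum_ord => lt_in.
  have n0 : (0 < n)%N by apply: leq_ltn_trans lt_in.
  by rewrite nth_nseq lt_in (nth_map (Ordinal n0)) // size_rev size_enum_ord.
by rewrite sumn_nseq expnS mulnC.
Qed.

Lemma envs_cat L1 L2 e :
  envs (L1 ++ L2) e = flatten [seq envs L2 f | f <- envs L1 e].
Proof.
elim: L1 e => [|v L1 IH] e /=; first by rewrite cats0.
elim: (rev _) => //= i s IHs.
by rewrite IHs IH map_cat flatten_cat.
Qed.

Lemma sumL_nil F e : sumL [::] F e = F e.
Proof. by rewrite /sumL /= big_seq1. Qed.

Lemma sumL_cons v L F e :
  sumL (v :: L) F e = \sum_i sumL L F (upd e v i).
Proof.
rewrite /sumL /= big_flatten /= big_map.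
rewrite -[RHS]big_enum /=.
by apply: perm_big; rewrite perm_rev.
Qed.

Lemma sumL_cat L1 L2 F e : sumL (L1 ++ L2) F e = sumL L1 (sumL L2 F) e.
Proof. by rewrite /sumL envs_cat big_flatten /= big_map. Qed.

Lemma sumL_agree L F e : uniq L ->
  sumL L F e = \sum_(f | agree L e f) F f.
Proof.
elim: L e => [|v L IH] e /=.
  move=> _; rewrite sumL_nil (big_pred1 e) // => f /=.
  apply/agreeP/eqP => [A|-> //]; apply/ffunP => v; exact: A.
move=> /andP[vL uL]; rewrite sumL_cons (partition_big (fun f : env => f v) predT) //=.
apply: eq_bigr => i _; rewrite IH //; apply: eq_bigl => f.
apply/agreeP/andP => [A|[/agreeP A /eqP fv] u uL'].
  split; last by rewrite A // ffunE eqxx.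
  apply/agreeP => u; rewrite inE negb_or => /andP[uv uL'].
  by rewrite A // ffunE (negPf uv).
rewrite ffunE; case: eqP => [->|/eqP uv] //.
by rewrite A // inE negb_or uv.
Qed.

Lemma eq_sumL L F G e : (forall f, agree L e f -> F f = G f) ->
  sumL L F e = sumL L G e.
Proof.
move=> FG; rewrite /sumL big_seq [RHS]big_seq.
by apply: eq_bigr => f /mem_envs /FG.
Qed.

Lemma sumL_mulr L F G e : indep L G ->
  sumL L F e * G e = sumL L (fun f => F f * G f) e.
Proof.
move=> iG; rewrite /sumL mulr_suml big_seq [RHS]big_seq.
by apply: eq_bigr => f /mem_envs /iG ->.
Qed.

Lemma indep_sub X Y T (F : env -> T) : {subset X <= Y} -> indep Y F -> indep X F.
Proof. by move=> sXY iF e f /(agree_sub sXY) /iF. Qed.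

Lemma indep_sumL X L F : indep X F -> indep X (sumL L F).
Proof.
elim: L => [|v L IH] iF e f ef; first by rewrite !sumL_nil; exact: iF.
rewrite !sumL_cons; apply: eq_bigr => i _.
by apply: IH => //; exact: agree_upd.
Qed.

Lemma indep_sumL_self L F : indep L (sumL L F).
Proof.
elim: L => [|v L IH] e f ef.
  have -> // : f = e by apply/ffunP => v; move/agreeP: ef; exact.
rewrite !sumL_cons; apply: eq_bigr => i _; apply: IH.
apply/agreeP => u uL; rewrite !ffunE; case: eqP => // /eqP uv.
by move/agreeP: ef; apply; rewrite inE negb_or uv.
Qed.

Lemma indep_cat X Y T (F : env -> T) : indep X F -> indep Y F -> indep (X ++ Y) F.
Proof.
move=> iX iY e f /agreeP ef.
(* The hybrid [g] differs from [e] on [X] only and from [f] on [Y] only. *)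
pose g : env := [ffun v => if v \in X then f v else e v].
rewrite (iY g f) ?(iX e g) //; apply/agreeP => v; rewrite ffunE.
  by move/negPf ->.
move=> vY; case: ifP => // /negbT vX; apply: ef.
by rewrite mem_cat negb_or vX.
Qed.

Lemma indep_mul X F G : indep X F -> indep X G -> indep X (fun e => F e * G e :> int).
Proof. by move=> iF iG e f ef; rewrite (iF e f) ?(iG e f). Qed.

Lemma norm_sumL L F (B : nat) e : (forall f, `|F f| <= B)%N ->
  (`|sumL L F e| <= n ^ size L * B)%N.
Proof.
move=> FB; rewrite -(size_envs L e) /sumL.
elim: (envs L e) => [|f s IH]; first by rewrite big_nil.
by rewrite big_cons /= mulSn; apply: leq_trans (leq_add (FB f) IH); exact: leq_absD.
Qed.

Lemma idx_cons_aux L e a :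
  foldl (fun a v => a * n + e v)%N a L = (a * n ^ size L + idx L e)%N.
Proof.
elim: L a => [|v L IH] a /=; first by rewrite muln1 addn0.
rewrite IH [in RHS]/idx /= IH mul0n add0n expnS.
by rewrite mulnDl -!mulnA !addnA.
Qed.

Lemma idx_cons v L e : idx (v :: L) e = (e v * n ^ size L + idx L e)%N.
Proof. by rewrite /idx /= mul0n add0n idx_cons_aux. Qed.

Lemma idx_cat L1 L2 e : idx (L1 ++ L2) e = (idx L1 e * n ^ size L2 + idx L2 e)%N.
Proof. by rewrite /idx foldl_cat idx_cons_aux. Qed.

Lemma idx_lt L e : (idx L e < n ^ size L)%N.
Proof.
elim: L => [|v L IH] //; rewrite idx_cons /= expnS.
have := ltn_ord (e v) => ev.
apply: (@leq_trans ((e v).+1 * n ^ size L)%N); first by rewrite mulSnr ltn_add2l.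
by rewrite leq_mul2r ev orbT.
Qed.

Lemma idx_inj L e f : idx L e = idx L f -> {in L, e =1 f}.
Proof.
elim: L => [|v L IH] //; rewrite !idx_cons => E.
have n0 : (0 < n ^ size L)%N by apply: leq_ltn_trans (idx_lt L e).
have Ev : e v = f v :> nat.
  have := congr1 (fun x => x %/ n ^ size L)%N E.
  by rewrite !divnMDl // !divn_small ?idx_lt // !addn0.
move: E; rewrite Ev => /eqP; rewrite eqn_add2l => /eqP /IH E u.
by rewrite inE => /orP[/eqP ->|/E //]; exact: ord_inj.
Qed.

Lemma eq_idx L e f : {in L, e =1 f} -> idx L e = idx L f.
Proof.
elim: L => [|v L IH] // E; rewrite !idx_cons E ?mem_head // IH // => u uL.
by apply: E; rewrite inE uL orbT.
Qed.

Lemma idx_onto L e (j : nat) : uniq L -> (j < n ^ size L)%N ->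
  exists2 f, agree L e f & idx L f = j.
Proof.
elim: L e j => [|v L IH] e j /=.
  by move=> _; rewrite ltnS leqn0 => /eqP ->; exists e => //; exact: agree_refl.
move=> /andP[vL uL]; rewrite expnS => jlt.
have n0 : (0 < n ^ size L)%N by move: jlt; case: (n ^ size L)%N => //; rewrite muln0.
have il : (j %/ n ^ size L < n)%N by rewrite ltn_divLR.
have [f ef If] := IH (upd e v (Ordinal il)) (j %% n ^ size L)%N uL (ltn_pmod _ n0).
exists f.
  apply/agreeP => u; rewrite inE negb_or => /andP[uv uL'].
  by move/agreeP: ef => ->; rewrite // ffunE (negPf uv).
rewrite idx_cons If; move/agreeP: ef => -> //; rewrite ffunE eqxx /=.
by rewrite -divn_eq.
Qed.

(** Bridge between assignments and matrices: the middle index of a matrix product runs over numbers,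
    whereas the sums to be computed run over assignments. *)
Lemma sumL_idx L (G : nat -> int) e : uniq L ->
  sumL L (fun f => G (idx L f)) e = \sum_(l < n ^ size L) G l.
Proof.
move=> uL; rewrite sumL_agree //.
(* The inverse of [idx] is found by search; by [idx_onto] the search never fails, so the default [e]
   is never taken. *)
rewrite [LHS](reindex_omap (op := +%R) (fun l : 'I_(n ^ size L) =>
  odflt e [pick f | agree L e f && (idx L f == l)])
  (fun f => Some (Ordinal (idx_lt L f)))) /=; last first.
  move=> f ef /=; case: pickP => [g /andP[eg /eqP E] /=|/(_ f)] /=; last by rewrite ef eqxx.
  congr Some; apply/ffunP => v; have [vL|vL] := boolP (v \in L); first exact: (idx_inj E).
  by move/agreeP: eg => ->; rewrite //; move/agreeP: ef => ->.
apply: eq_big => [l|l]; last first.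
  case: pickP => [g /andP[_ /eqP E] _|] /=; first by rewrite E.
  have [f ef If] := idx_onto e uL (ltn_ord l).
  by move/(_ f); rewrite ef If eqxx.
have [f ef If] := idx_onto e uL (ltn_ord l).
case: pickP => [g /andP[eg /eqP E] /=|/(_ f)]; last by rewrite ef If eqxx.
by rewrite eg; apply/eqP; congr Some; apply: val_inj.
Qed.

End Environments.

(** * Inclusion-exclusion over quotients *)

Section InjectivityExpansion.

Variable V : finType.

Implicit Types q : {ffun V -> V}.

(** A quotient is encoded by an idempotent map that sends every vertex to a representative of its
    class. Merging keeps the representative of the class of [v]. *)
Definition merge (q : {ffun V -> V}) (u v : V) : {ffun V -> V} :=
  [ffun w => if q w == q u then q v else q w].

Definition idem (q : {ffun V -> V}) : bool := [forall w, q (q w) == q w].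

Definition respects (T : eqType) (q : {ffun V -> V}) (f : V -> T) : bool :=
  [forall w, f (q w) == f w].

Lemma idemP q : reflect (forall w, q (q w) = q w) (idem q).
Proof. exact: 'forall_eqP. Qed.

Lemma respectsP (T : eqType) q (f : V -> T) :
  reflect (forall w, f (q w) = f w) (respects q f).
Proof. exact: 'forall_eqP. Qed.

Lemma merge_idem q u v : idem q -> idem (merge q u v).
Proof.
move=> /idemP qq; apply/idemP => w; rewrite !ffunE.
by case: (eqVneq (q w) (q u)) => [_|wu]; rewrite qq; [case: ifP | rewrite (negPf wu)].
Qed.

Lemma respects_merge (T : eqType) q u v (f : V -> T) : idem q ->
  respects (merge q u v) f = respects q f && (f u == f v).
Proof.
move=> /idemP qq; apply/respectsP/andP => [fm|[/respectsP fq /eqP fuv] w]; last first.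
  by rewrite ffunE; case: eqP => [E|_]; rewrite ?fq // -[RHS]fq E fq.
have fq w : f (q w) = f w.
  by rewrite -[LHS]fm -[RHS]fm !ffunE qq.
split; first exact/respectsP.
by rewrite -(fm u) ffunE eqxx fq.
Qed.

(** The list is chosen before [T] and [f], so a single list serves host graphs of every size and can
    be written into a program. *)
Lemma injectivity_expansion :
  exists2 qs : seq (int * {ffun V -> V}), all (fun x => idem x.2) qs
  & forall (T : eqType) (f : V -> T),
      (injectiveb f)%:R = \sum_(x <- qs) x.1 * (respects x.2 f)%:R.
Proof.
(* The pairs are ordered, so each condition occurs twice; this is harmless because the factors are 0
   or 1. *)
suff [qs qsI qsE] : exists2 qs : seq (int * {ffun V -> V}), all (fun x => idem x.2) qs
  & forall (T : eqType) (f : V -> T),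
      \prod_(c <- enum {: V * V} | c.1 != c.2) (1 - (f c.1 == f c.2)%:R) =
      \sum_(x <- qs) x.1 * (respects x.2 f)%:R :> int.
  exists qs => // T f; rewrite -qsE big_enum_cond /=.
  have [/injectiveP f_inj|] := boolP (injectiveb f).
    rewrite big1 // => c /= cc.
    by case: eqP => [/f_inj E|]; rewrite ?subr0 //; rewrite E eqxx in cc.
  move/injectivePn => [x [y xy fxy]].
  by rewrite (bigD1 (x, y)) //= fxy eqxx subrr mul0r.
elim: (enum _) => [|c s [qs qsI qsE]].
  exists [:: (1, [ffun w => w])].
    by rewrite /= andbT; apply/idemP => w; rewrite !ffunE.
  move=> T f; rewrite big_nil big_seq1 /= mul1r.
  by rewrite (_ : respects _ _); last by apply/respectsP => w; rewrite ffunE.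
case: (boolP (c.1 != c.2)) => cc; last first.
  by exists qs => // T f; rewrite big_cons (negPf cc) qsE.
(* Distributing one more factor doubles the list: each quotient stays, and its merge along [c]
   enters with the opposite sign. *)
exists (qs ++ [seq (- x.1, merge x.2 c.1 c.2) | x <- qs]).
  rewrite all_cat qsI /= all_map; apply: sub_all qsI => x /=; exact: merge_idem.
move=> T f; rewrite big_cons cc qsE big_cat big_map /= mulrBl mul1r; congr (_ + _).
rewrite mulr_sumr -sumrN big_seq [RHS]big_seq; apply: eq_bigr => x /(allP qsI) xI.
by rewrite respects_merge // -mulnb natrM; ring.
Qed.

End InjectivityExpansion.

(** * Copies of the pattern and embeddings *)

Section CopiesAndEmbeddings.

Variables (U V : finType) (P : sgraph U) (H : sgraph V).

Definition is_hom (f : U -> V) : bool :=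
  [forall u, forall v, P u v ==> H (f u) (f v)].

Definition embeddings : {set {ffun U -> V}} :=
  [set f : {ffun U -> V} | injectiveb f && is_hom f].

Definition automorphisms : {set {perm U}} :=
  [set s : {perm U} | [forall u, forall v, P (s u) (s v) == P u v]].

Definition copy (f : {ffun U -> V}) : {set V} * {set {set V}} :=
  ([set f u | u : U], [set [set f e.1; f e.2] | e : U * U & P e.1 e.2]).

Lemma automorphisms_gt0 : (0 < #|automorphisms|)%N.
Proof.
apply/card_gt0P; exists 1%g; rewrite inE.
by apply/forallP => u; apply/forallP => v; rewrite !perm1.
Qed.

Lemma set2_eq (T : finType) (a b c d : T) : [set a; b] = [set c; d] ->
  (a = c /\ b = d) \/ (a = d /\ b = c).
Proof.
move=> E; have := set21 a b; have := set22 a b; rewrite E !inE.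
have := set21 c d; have := set22 c d; rewrite -E !inE.
by do 4![case/orP => /eqP ?]; subst; auto.
Qed.

Lemma mem_copy (f : {ffun U -> V}) u v : injective f ->
  ([set f u; f v] \in (copy f).2) = P u v.
Proof.
move=> fI; apply/imsetP/idP => [[[a b]]|Puv]; last by exists (u, v); rewrite ?inE.
rewrite inE /= => Pab /set2_eq [] [/fI -> /fI ->] //.
by rewrite adj_sym.
Qed.

Lemma copy_isomorphic (f : {ffun U -> V}) : f \in embeddings ->
  is_subgraph H (copy f) && isomorphic_to P (copy f).
Proof.
rewrite inE => /andP[/injectiveP fI /forallP fH]; apply/andP; split.
  apply/andP; split.
    apply/subsetP => X /imsetP[[u v]]; rewrite inE /= => Puv ->.
    apply/imsetP; exists (f u, f v) => //; rewrite inE /=.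
    by move/forallP: (fH u) => /(_ v); rewrite Puv.
  apply/forallP => X; apply/implyP => /imsetP[[u v]] _ /= ->.
  by apply/subsetP => x; rewrite !inE => /orP[] /eqP ->; rewrite imset_f.
apply/existsP; exists f; rewrite eqxx /= andbC; apply/andP; split; last exact/injectiveP.
by apply/forallP => u; apply/forallP => v; rewrite mem_copy // eqxx.
Qed.

Lemma isomorphic_copy X : is_subgraph H X -> isomorphic_to P X ->
  exists2 f, f \in embeddings & X = copy f.
Proof.
case: X => S F /andP[/= /subsetP FH /forallP FS] /existsP[f].
move=> /and3P[/injectiveP fI /eqP /= fS /forallP /= fF].
have fP u v : P u v = ([set f u; f v] \in F) by apply/eqP; move/forallP: (fF u); exact.
exists f; last first.
  congr (_, _); first by rewrite -fS.
  apply/setP => e; apply/idP/imsetP => [eF|[[u v]]]; last first.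
    by rewrite inE /= fP => ? ->.
  (* An edge of [X] is an edge of [H], hence a pair, and its ends lie in [S], the image of [f]. So
     [F] contains nothing besides images of pairs of pattern vertices. *)
  have /imsetP[[x y]] := FH _ eF; rewrite inE /= => Hxy eE.
  have /subsetP eS : e \subset S by have := FS e; rewrite eF.
  have /imsetP[u _ xE] : x \in [set f u | u : U] by rewrite fS; apply: eS; rewrite eE set21.
  have /imsetP[v _ yE] : y \in [set f u | u : U] by rewrite fS; apply: eS; rewrite eE set22.
  by exists (u, v); rewrite ?inE /= ?fP -?xE -?yE -?eE.
rewrite inE; apply/andP; split; first exact/injectiveP.
apply/forallP => u; apply/forallP => v; apply/implyP; rewrite fP => /FH /imsetP[[x y]].
by rewrite inE /= => Hxy /set2_eq [] [-> ->] //; rewrite adj_sym.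
Qed.

(** The embeddings with the same copy as [f0] are the maps [f0] after an automorphism [s];
    conversely [s] is recovered as the inverse of [f0] applied to [f]. *)
Lemma card_same_copy f0 : f0 \in embeddings ->
  #|[set f in embeddings | copy f == copy f0]| = #|automorphisms|.
Proof.
move=> f0E; have := f0E; rewrite inE => /andP[/injectiveP f0I /forallP f0H].
pose g (s : {perm U}) : {ffun U -> V} := [ffun u => f0 (s u)].
have g_inj : injective g.
  by move=> s t /ffunP E; apply/permP => u; have := E u; rewrite !ffunE => /f0I.
rewrite -(card_imset _ g_inj); apply: eq_card => f; rewrite inE.
apply/andP/imsetP => [[fE /eqP cE]|[s sA ->]].
  have := fE; rewrite inE => /andP[/injectiveP fI _].
  have ex u : exists v, f0 v == f u.
    have : f u \in (copy f0).1 by rewrite -cE /= imset_f.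
    by move=> /imsetP[v _ ->]; exists v.
  pose s u := xchoose (ex u).
  have sE u : f0 (s u) = f u by exact/eqP/(xchooseP (ex u)).
  have s_inj : injective s by move=> u v E; apply: fI; rewrite -!sE E.
  exists (perm s_inj); last by apply/ffunP => u; rewrite ffunE permE sE.
  rewrite inE; apply/forallP => u; apply/forallP => v; rewrite !permE.
  by rewrite -(mem_copy _ _ f0I) !sE -cE mem_copy.
have sP u v : P (s u) (s v) = P u v.
  by move: sA; rewrite inE => /forallP/(_ u)/forallP/(_ v)/eqP.
split.
  rewrite inE; apply/andP; split.
    by apply/injectiveP => u v; rewrite !ffunE => /f0I /perm_inj.
  apply/forallP => u; apply/forallP => v; rewrite !ffunE -sP.
  by move/forallP: (f0H (s u)).
apply/eqP; congr (_, _).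
  apply/setP => x; apply/imsetP/imsetP => [[u _ ->]|[u _ ->]].
    by exists (s u); rewrite ?ffunE.
  by exists (s^-1%g u); rewrite // ffunE permKV.
apply/setP => x; apply/imsetP/imsetP => [[[u v]]|[[u v]]]; rewrite inE /= => Puv ->.
  by exists (s u, s v); rewrite ?inE /= ?sP ?ffunE.
exists (s^-1%g u, s^-1%g v); last by rewrite /= !ffunE !permKV.
by rewrite inE /= -sP !permKV.
Qed.

Lemma card_embeddings :
  #|embeddings| = (count_subgraphs P H * #|automorphisms|)%N.
Proof.
have -> : count_subgraphs P H = #|copy @: embeddings|.
  apply: eq_card => X; rewrite inE; apply/andP/imsetP => [[XH XP]|[f fE ->]].
    by have [f] := isomorphic_copy XH XP; exists f.
  exact/andP/copy_isomorphic.
rewrite -sum1_card (partition_big_imset copy) /= -sum_nat_const.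
apply: eq_bigr => X /imsetP[f0 f0E ->].
by rewrite -(card_same_copy f0E) -sum1_card; apply: eq_bigl => f; rewrite inE.
Qed.

Lemma embeddings_expansion (qs : seq (int * {ffun U -> U})) :
  (forall f : {ffun U -> V},
     (injectiveb f)%:R = \sum_(x <- qs) x.1 * (respects x.2 f)%:R) ->
  (#|embeddings|)%:R =
    \sum_(x <- qs) x.1 * \sum_(f : {ffun U -> V} | respects x.2 f) (is_hom f)%:R.
Proof.
move=> qsE; rewrite -sum1_card natr_sum.
transitivity (\sum_(f : {ffun U -> V}) (injectiveb f)%:R * (is_hom f)%:R : int).
  rewrite big_mkcond /=; apply: eq_bigr => f _; rewrite inE -natrM mulnb.
  by case: (_ && _).
under eq_bigr do rewrite qsE mulr_suml.
rewrite exchange_big /=; apply: eq_bigr => x _; rewrite mulr_sumr [RHS]big_mkcond /=.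
by apply: eq_bigr => f _; case: respects; rewrite ?mulr1 // mulr0 mul0r.
Qed.

End CopiesAndEmbeddings.

(** * Splitting a quotient into three tables *)

(** Lists are regrouped many times below. Phrased with [count], the absence of duplicates in a
    regrouped sublist becomes linear arithmetic. *)
Lemma uniq_leq_count (T : eqType) (s1 s2 : seq T) : uniq s2 ->
  (forall a, count a s1 <= count a s2)%N -> uniq s1.
Proof.
move=> u2 H; apply: count_mem_uniq => x; have := H (pred1 x).
have -> : (x \in s1) = (0 < count_mem x s1)%N by rewrite -has_count has_pred1.
rewrite (count_uniq_mem _ u2).
by case: (count_mem x s1) (x \in s2) => [|[|m]] [].
Qed.

(** * Factoring sums over assignments *)

Section Sums.

Variables (V : finType) (n : nat).

Local Notation env := {ffun V -> 'I_n}.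

(** A map constant on the classes is determined by its free values on the representatives. Off [R]
    the environments are frozen to [e], which makes the correspondence bijective. *)
Lemma sum_respects (q : {ffun V -> V}) (W : env -> int) R (e : env) :
  idem q -> uniq R -> (forall w, (w \in R) = (q w == w)) ->
  \sum_(f : env | respects q f) W f =
  sumL R (fun f => W [ffun w => f (q w)]) e.
Proof.
move=> /idemP qq uR RE; rewrite sumL_agree //.
pose h (f : env) : env := [ffun w => f (q w)].
pose h' (f : env) : env := [ffun w => if w \in R then f w else e w].
have qR w : q w \in R by rewrite RE qq.
rewrite (reindex_onto h h') /= => [|f /respectsP fq]; last first.
  by apply/ffunP => w; rewrite !ffunE qR fq.
apply: eq_bigl => f; apply/andP/agreeP => [[_ /eqP hf] w wR|fe].
  by rewrite -hf ffunE (negPf wR).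
split; first by apply/respectsP => w; rewrite !ffunE qq.
apply/eqP/ffunP => w; rewrite !ffunE; case: (boolP (w \in R)) => wR; last by rewrite fe.
by move: wR; rewrite RE => /eqP ->.
Qed.

(** Distributivity. The left side is what the program computes: private sums, then a matrix product
    over [B], then a sum weighted by the remaining table. The independence hypotheses let each sum
    move inwards past the factors that ignore its variables. *)
Lemma sumL_factor O A B C L1 L2 L3 (W1 W2 W3 : env -> int) e0 :
  indep (L3 ++ L2) W1 -> indep (L1 ++ L2) W3 -> indep (B ++ L1 ++ L3) W2 ->
  sumL (O ++ A ++ C) (fun e =>
    sumL B (fun f => sumL L1 W1 f * sumL L3 W3 f) e * sumL L2 W2 e) e0 =
  sumL (O ++ A ++ C ++ B ++ L1 ++ L3 ++ L2) (fun e => W1 e * W3 e * W2 e) e0.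
Proof.
move=> i1 i3 i2.
have sub1 : {subset L3 <= L3 ++ L2} by move=> w wL; rewrite mem_cat wL.
have sub2 : {subset L2 <= L3 ++ L2} by move=> w wL; rewrite mem_cat wL orbT.
have sub3 : {subset L1 <= L1 ++ L2} by move=> w wL; rewrite mem_cat wL.
have sub4 : {subset L2 <= L1 ++ L2} by move=> w wL; rewrite mem_cat wL orbT.
have -> : O ++ A ++ C ++ B ++ L1 ++ L3 ++ L2 = (O ++ A ++ C) ++ B ++ L1 ++ L3 ++ L2.
  by rewrite -!catA.
rewrite [RHS]sumL_cat; apply: eq_sumL => e _.
have -> : B ++ L1 ++ L3 ++ L2 = (B ++ L1 ++ L3) ++ L2 by rewrite -!catA.
rewrite [RHS]sumL_cat.
transitivity (sumL (B ++ L1 ++ L3) (fun f => W1 f * W3 f) e * sumL L2 W2 e).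
  congr (_ * _); rewrite [RHS]sumL_cat; apply: eq_sumL => f _.
  rewrite sumL_mulr; last exact/indep_sumL/(indep_sub sub3).
  rewrite [RHS]sumL_cat; apply: eq_sumL => g _.
  rewrite [LHS]mulrC sumL_mulr; last exact: indep_sub i1.
  by apply: eq_sumL => h _; rewrite mulrC.
rewrite sumL_mulr; last exact: indep_sumL.
apply: eq_sumL => f _ /=; rewrite [LHS]mulrC.
rewrite (@sumL_mulr _ _ _ _ (fun f => W1 f * W3 f)); last first.
  by apply: indep_mul; [exact: indep_sub i1 | exact: indep_sub i3].
by apply: eq_sumL => g _; rewrite mulrC.
Qed.

Definition edge_prod (H : rel 'I_n) (cs : seq (V * V)) (e : env) : int :=
  \prod_(c <- cs) (H (e c.1) (e c.2))%:R.

Lemma edge_prodE H cs e :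
  edge_prod H cs e = (all (fun c => H (e c.1) (e c.2)) cs)%:R.
Proof.
rewrite /edge_prod; elim: cs => [|c cs IH]; first by rewrite big_nil.
by rewrite big_cons IH -natrM mulnb.
Qed.

Lemma edge_prod_indep H cs X :
  (forall c, c \in cs -> (c.1 \notin X) && (c.2 \notin X)) ->
  indep X (edge_prod H cs).
Proof.
move=> csX e f /agreeP A; rewrite /edge_prod big_seq [RHS]big_seq.
by apply: eq_bigr => c /csX /andP[c1 c2]; rewrite !A.
Qed.

End Sums.

(* For fixed values of [pl_O], the three kinds of shared variables [pl_A],
   [pl_B], [pl_C] index the rows and columns of the two matrices. The i-th table
   is indexed by [pl_table]i and sums over the variables [pl_priv]i, which occur
   in no other table. *)
Record plan (V : finType) := Plan {
  pl_O : seq V; pl_A : seq V; pl_B : seq V; pl_C : seq V;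
  pl_table1 : seq V; pl_table2 : seq V; pl_table3 : seq V;
  pl_priv1 : seq V; pl_priv2 : seq V; pl_priv3 : seq V;
  pl_edges1 : seq (V * V); pl_edges2 : seq (V * V); pl_edges3 : seq (V * V) }.

Definition plan_vars (V : finType) (x : plan V) : seq V :=
  pl_O x ++ pl_A x ++ pl_C x ++ pl_B x ++ pl_priv1 x ++ pl_priv3 x ++ pl_priv2 x.

Definition within (V : finType) (X : seq V) (cs : seq (V * V)) : bool :=
  all (fun c => (c.1 \in X) && (c.2 \in X)) cs.

Record plan_ok (V : finType) (x : plan V) : Prop := PlanOk {
  ok_uniq : uniq (plan_vars x);
  ok_sizeB : size (pl_B x) = size (pl_A x);
  ok_sizeC : size (pl_C x) = size (pl_A x);
  ok_uniq1 : uniq (pl_table1 x);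
  ok_uniq2 : uniq (pl_table2 x);
  ok_uniq3 : uniq (pl_table3 x);
  ok_sub1 : {subset pl_table1 x <= pl_O x ++ pl_A x ++ pl_B x};
  ok_sub2 : {subset pl_table2 x <= pl_O x ++ pl_A x ++ pl_C x};
  ok_sub3 : {subset pl_table3 x <= pl_O x ++ pl_B x ++ pl_C x};
  ok_edges1 : within (pl_table1 x ++ pl_priv1 x) (pl_edges1 x);
  ok_edges2 : within (pl_table2 x ++ pl_priv2 x) (pl_edges2 x);
  ok_edges3 : within (pl_table3 x ++ pl_priv3 x) (pl_edges3 x) }.

Definition plan_value (V : finType) (x : plan V) (n : nat) (H : rel 'I_n)
    (e : {ffun V -> 'I_n}) : int :=
  sumL (plan_vars x) (fun f => edge_prod H (pl_edges1 x) f *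
    edge_prod H (pl_edges3 x) f * edge_prod H (pl_edges2 x) f) e.

(** Denominators are cleared. Filling table i takes one loop per indexed or private variable, within
    the budget 2p+2+k/3. The last bound is |O| + (8/3)|A| <= 2p+2+4k/9, with 8/3 in the place of
    omega. *)
Definition plan_cheap (V : finType) (x : plan V) (p : nat) : Prop :=
  [/\ (3 * (size (pl_table1 x) + size (pl_priv1 x)) <= 3 * (2 * p + 2) + #|V|)%N,
      (3 * (size (pl_table2 x) + size (pl_priv2 x)) <= 3 * (2 * p + 2) + #|V|)%N,
      (3 * (size (pl_table3 x) + size (pl_priv3 x)) <= 3 * (2 * p + 2) + #|V|)%N
    & (9 * size (pl_O x) + 24 * size (pl_A x) <= 9 * (2 * p + 2) + 4 * #|V|)%N].

(** * The plan of a quotient *)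

Section PlanOfQuotient.

Variables (V : finType) (P : sgraph V) (part : V -> nat).

Hypothesis part_le3 : forall v, (part v <= 3)%N.
Hypothesis part_edge : forall u v, P u v ->
  [|| part u == 0%N, part v == 0%N | part u == part v].

Variable q : {ffun V -> V}.
Hypothesis q_idem : idem q.

(** The class represented by [w] meets part [i]; part 0 consists of the separating vertices. *)
Definition touches (w : V) (i : nat) : bool := [exists u, (q u == w) && (part u == i)].

Definition fixed : seq V := [seq w <- enum V | q w == w].

(** In the notation of the overview, a, b, c and t are the sizes for the flags 110, 101, 011 and
    111; the classes with a single flag are private to one table. *)
Definition class (b1 b2 b3 : bool) : seq V :=
  [seq w <- fixed | [&& ~~ touches w 0, touches w 1 == b1, touches w 2 == b2
                      & touches w 3 == b3]].

Definition class0 : seq V := [seq w <- fixed | touches w 0].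

(** Edges between separating vertices occur for every [i], and every edge in both directions;
    repeated 0/1 factors do not change the product. *)
Definition part_edges (i : nat) : seq (V * V) :=
  [seq (q c.1, q c.2) | c <- enum {: V * V} &
     [&& P c.1 c.2, (part c.1 == 0%N) || (part c.1 == i)
       & (part c.2 == 0%N) || (part c.2 == i)]].

(** The common size m to which the three kinds of shared variables are cut, so that all matrices are
    square. The surplus of each kind joins the outer loop. *)
Definition blk : nat :=
  minn (size (class true true false))
    (minn (size (class true false true)) (size (class false true true))).

(** The kind {1,3} is common to tables 1 and 3 and is summed in their product; this leaves the kinds
    {1,2} and {2,3}, which are those of table 2. *)
Definition quotient_plan : plan V := {|
  pl_O := class0 ++ class true true true ++ drop blk (class true true false) ++
    drop blk (class true false true) ++ drop blk (class false true true);
  pl_A := take blk (class true true false);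
  pl_B := take blk (class true false true);
  pl_C := take blk (class false true true);
  pl_table1 := class0 ++ class true true true ++ class true true false ++ class true false true;
  pl_table2 := class0 ++ class true true true ++ class true true false ++ class false true true;
  pl_table3 := class0 ++ class true true true ++ class true false true ++ class false true true;
  pl_priv1 := class true false false;
  pl_priv2 := class false true false;
  pl_priv3 := class false false true;
  pl_edges1 := part_edges 1; pl_edges2 := part_edges 2; pl_edges3 := part_edges 3 |}.

Lemma fixed_touches w : w \in fixed ->
  [|| touches w 0, touches w 1, touches w 2 | touches w 3].
Proof.
rewrite mem_filter => /andP[/eqP qw _].
have : touches w (part w) by apply/existsP; exists w; rewrite qw !eqxx.
by have := part_le3 w; case: (part w) => [|[|[|[|]]]] // _ ->; rewrite ?orbT.
Qed.

(** The kind with no flag at all is missing from the list: by [fixed_touches] a class that avoids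
    the separators meets some part. *)
Lemma perm_classes :
  perm_eq (class0 ++ class true true true ++ class true true false ++
    class true false true ++ class false true true ++ class true false false ++
    class false true false ++ class false false true) fixed.
Proof.
apply/seq.permP => a; rewrite !count_cat /class /class0.
have := fixed_touches; elim: fixed => //= w s IH H.
have {}IH := IH (fun v vs => H v (@mem_behead _ (w :: s) v vs)).
have := H w (mem_head _ _); rewrite -{}IH.
by case: (touches w 0); case: (touches w 1); case: (touches w 2);
  case: (touches w 3) => //= _; rewrite ?addnA; lia.
Qed.

Lemma uniq_fixed : uniq fixed.
Proof. exact/filter_uniq/enum_uniq. Qed.

(** These representatives are images under [q] of vertices of part [i]. *)
Lemma size_touching s i : uniq s -> (forall w, w \in s -> touches w i) ->
  (size s <= #|[set v | part v == i]|)%N.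
Proof.
move=> us st; rewrite -(card_uniqP us).
apply: leq_trans (leq_imset_card q _); apply: subset_leq_card.
apply/subsetP => w /st /existsP[u /andP[/eqP <- ui]].
by apply: imset_f; rewrite inE.
Qed.

Lemma plan_vars_perm : perm_eq (plan_vars quotient_plan) fixed.
Proof.
apply: perm_trans perm_classes; apply/seq.permP => a.
rewrite /plan_vars /= !count_cat.
rewrite -[in RHS](cat_take_drop blk (class true true false)).
rewrite -[in RHS](cat_take_drop blk (class true false true)).
rewrite -[in RHS](cat_take_drop blk (class false true true)).
rewrite !count_cat; lia.
Qed.

Lemma class_touches b1 b2 b3 w : w \in class b1 b2 b3 ->
  [/\ ~~ touches w 0, touches w 1 = b1, touches w 2 = b2 & touches w 3 = b3].
Proof. by rewrite mem_filter => /andP[/and4P[? /eqP ? /eqP ? /eqP ?] _]. Qed.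

Lemma mem_class w : w \in fixed -> ~~ touches w 0 ->
  w \in class (touches w 1) (touches w 2) (touches w 3).
Proof. by move=> wf w0; rewrite mem_filter w0 !eqxx. Qed.

Lemma edge_mem i c : (0 < i <= 3)%N -> c \in part_edges i ->
  [/\ (c.1 \in fixed) && (c.2 \in fixed), touches c.1 0 || touches c.1 i
    & touches c.2 0 || touches c.2 i].
Proof.
move=> _ /mapP[[u v]]; rewrite mem_filter /= => /andP[/and3P[_ pu pv] _] -> /=.
have t w : (part w == 0%N) || (part w == i) -> touches (q w) 0 || touches (q w) i.
  case/orP => E; apply/orP; [left|right]; apply/existsP; exists w;
  by rewrite eqxx.
have f w : q w \in fixed by rewrite mem_filter (idemP _ q_idem) eqxx mem_enum.
by split; [rewrite !f|exact: t|exact: t].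
Qed.

(** No edge joins two different parts, so each edge of [P] lies within the separators and one part,
    and one of the three edge lists checks it. *)
Lemma quotient_plan_value n (H : sgraph 'I_n) e :
  \sum_(f : {ffun V -> 'I_n} | respects q f) (is_hom P H f)%:R =
  plan_value quotient_plan H e.
Proof.
have pf := plan_vars_perm.
rewrite (sum_respects _ (R := plan_vars quotient_plan) e q_idem); last 2 first.
- by rewrite (perm_uniq pf) uniq_fixed.
- by move=> w; rewrite (perm_mem pf) mem_filter mem_enum andbT.
apply: eq_sumL => f _; rewrite !edge_prodE -!natrM !mulnb; congr (nat_of_bool _)%:R.
rewrite !all_map /=.
apply/forallP/idP => [fH|].
  rewrite -!andbA; apply/and3P.
  by split; apply/allP => -[u v]; rewrite mem_filter /= => /andP[/and3P[Puv _ _] _];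
    move: (fH u) => /forallP/(_ v); rewrite Puv !ffunE.
move=> /andP[/andP[/allP A1 /allP A3] /allP A2] u; apply/forallP => v.
apply/implyP => Puv; rewrite !ffunE.
have mem i : (part u == 0%N) || (part u == i) -> (part v == 0%N) || (part v == i) ->
    (u, v) \in [seq c <- enum {: V * V} | [&& P c.1 c.2,
      (part c.1 == 0%N) || (part c.1 == i) & (part c.2 == 0%N) || (part c.2 == i)]].
  by move=> pu pv; rewrite mem_filter /= Puv pu pv mem_enum.
(* The part of an end that is not a separating vertex; if both ends are separating, any part will do
   and 1 is taken. *)
have [i [i13 pu pv]] : exists i, [/\ (0 < i <= 3)%N, (part u == 0%N) || (part u == i)
    & (part v == 0%N) || (part v == i)].
  have := part_edge Puv; case: (eqVneq (part u) 0%N) => [->|pu] /=.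
    move=> _; exists (if part v == 0%N then 1%N else part v).
    by case: (eqVneq (part v) 0%N) => [->|pv] //=; rewrite lt0n pv part_le3 eqxx.
  move=> pv; exists (part u).
  rewrite lt0n pu part_le3 eqxx; split=> //.
  by rewrite [part v == part u]eq_sym.
move: i13 pu pv; case: i => [|[|[|[|]]]] // _ pu pv.
- exact: (A1 (u, v) (mem 1%N pu pv)).
- exact: (A2 (u, v) (mem 2 pu pv)).
- exact: (A3 (u, v) (mem 3 pu pv)).
Qed.

Lemma quotient_plan_ok : plan_ok quotient_plan.
Proof.
have u8 : uniq (class0 ++ class true true true ++ class true true false ++
    class true false true ++ class false true true ++ class true false false ++
    class false true false ++ class false false true).
  by rewrite (perm_uniq perm_classes) uniq_fixed.
have sz1 : (blk <= size (class true true false))%N by rewrite geq_minl.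
have sz2 : (blk <= size (class true false true))%N.
  by apply: leq_trans (geq_minr _ _) (geq_minl _ _).
have sz3 : (blk <= size (class false true true))%N.
  by apply: leq_trans (geq_minr _ _) (geq_minr _ _).
have mcat (s : seq V) w : (w \in s) = (w \in take blk s) || (w \in drop blk s).
  by rewrite -mem_cat cat_take_drop.
have uniq_sub (s : seq V) : (forall a, count a s <= count a
    (class0 ++ class true true true ++ class true true false ++
    class true false true ++ class false true true ++ class true false false ++
    class false true false ++ class false false true))%N -> uniq s.
  exact: uniq_leq_count.
split; rewrite /= ?size_takel //.
- by rewrite (perm_uniq plan_vars_perm) uniq_fixed.
- by apply: uniq_sub => a; rewrite !count_cat; lia.
- by apply: uniq_sub => a; rewrite !count_cat; lia.
- by apply: uniq_sub => a; rewrite !count_cat; lia.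
- move=> w; rewrite !mem_cat (mcat (class true true false)) (mcat (class true false true)).
  by do !case/orP => [|]; do ?[move=> ->]; rewrite ?orbT.
- move=> w; rewrite !mem_cat (mcat (class true true false)) (mcat (class false true true)).
  by do !case/orP => [|]; do ?[move=> ->]; rewrite ?orbT.
- move=> w; rewrite !mem_cat (mcat (class true false true)) (mcat (class false true true)).
  by do !case/orP => [|]; do ?[move=> ->]; rewrite ?orbT.
- have t w : w \in fixed -> touches w 0 || touches w 1 -> w \in
      pl_table1 quotient_plan ++ pl_priv1 quotient_plan.
    move=> wf; case: (boolP (touches w 0)) => [w0 _|w0 /= w1].
      by rewrite !mem_cat mem_filter w0 wf.
    have := mem_class wf w0; rewrite w1 !mem_cat.
    by case: (touches w 2); case: (touches w 3) => ->; rewrite ?orbT.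
  by apply/allP => c /(@edge_mem 1 _ isT) [/andP[f1 f2] t1 t2]; rewrite !t.
- have t w : w \in fixed -> touches w 0 || touches w 2 -> w \in
      pl_table2 quotient_plan ++ pl_priv2 quotient_plan.
    move=> wf; case: (boolP (touches w 0)) => [w0 _|w0 /= w1].
      by rewrite !mem_cat mem_filter w0 wf.
    have := mem_class wf w0; rewrite w1 !mem_cat.
    by case: (touches w 1); case: (touches w 3) => ->; rewrite ?orbT.
  by apply/allP => c /(@edge_mem 2 _ isT) [/andP[f1 f2] t1 t2]; rewrite !t.
- have t w : w \in fixed -> touches w 0 || touches w 3 -> w \in
      pl_table3 quotient_plan ++ pl_priv3 quotient_plan.
    move=> wf; case: (boolP (touches w 0)) => [w0 _|w0 /= w1].
      by rewrite !mem_cat mem_filter w0 wf.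
    have := mem_class wf w0; rewrite w1 !mem_cat.
    by case: (touches w 1); case: (touches w 2) => ->; rewrite ?orbT.
  by apply/allP => c /(@edge_mem 3 _ isT) [/andP[f1 f2] t1 t2]; rewrite !t.
Qed.

Variable p : nat.

Hypothesis card_part0 : (#|[set v | part v == 0%N]| <= 2 * p + 2)%N.
Hypothesis card_part : forall i, (0 < i <= 3)%N ->
  (3 * #|[set v | part v == i]| <= #|V|)%N.

(** For the last bound let c = m be the smallest kind. Apart from [class0], the left side is
    9(t+a+b+c-3m) + 24m = 9(t+a+b) + 6m. Here 9(t+a+b) <= 3k because these classes share a part, and
    6m <= k because two kinds of size at least m share a part. *)
Lemma quotient_plan_cheap : plan_cheap quotient_plan p.
Proof.
have s0 : (size class0 <= 2 * p + 2)%N.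
  apply: leq_trans card_part0; apply: size_touching.
    exact/filter_uniq/uniq_fixed.
  by move=> w; rewrite mem_filter => /andP[].
have u8 : uniq (class0 ++ class true true true ++ class true true false ++
    class true false true ++ class false true true ++ class true false false ++
    class false true false ++ class false false true).
  by rewrite (perm_uniq perm_classes) uniq_fixed.
have uniq_sub (s : seq V) : (forall a, count a s <= count a
    (class0 ++ class true true true ++ class true true false ++
    class true false true ++ class false true true ++ class true false false ++
    class false true false ++ class false false true))%N -> uniq s.
  exact: uniq_leq_count.
have s1 : (3 * (size (class true true true) + size (class true true false) +
    size (class true false true) + size (class true false false)) <= #|V|)%N.
  apply: leq_trans (card_part (isT : 0 < 1 <= 3)%N); rewrite leq_mul2l -!size_cat.
  apply: size_touching => [|w].
    by apply: uniq_sub => a; rewrite !count_cat; lia.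
  by rewrite !mem_cat -!orbA => /or4P[] /class_touches[_ -> _ _].
have s2 : (3 * (size (class true true true) + size (class true true false) +
    size (class false true true) + size (class false true false)) <= #|V|)%N.
  apply: leq_trans (card_part (isT : 0 < 2 <= 3)%N); rewrite leq_mul2l -!size_cat.
  apply: size_touching => [|w].
    by apply: uniq_sub => a; rewrite !count_cat; lia.
  by rewrite !mem_cat -!orbA => /or4P[] /class_touches[_ _ -> _].
have s3 : (3 * (size (class true true true) + size (class true false true) +
    size (class false true true) + size (class false false true)) <= #|V|)%N.
  apply: leq_trans (card_part (isT : 0 < 3 <= 3)%N); rewrite leq_mul2l -!size_cat.
  apply: size_touching => [|w].
    by apply: uniq_sub => a; rewrite !count_cat; lia.
  by rewrite !mem_cat -!orbA => /or4P[] /class_touches[_ _ _ ->].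
have blkE : blk = minn (size (class true true false))
    (minn (size (class true false true)) (size (class false true true))) by [].
have sz1 : (blk <= size (class true true false))%N by rewrite geq_minl.
split; rewrite /= !size_cat ?size_takel ?size_drop //; move: s0 s1 s2 s3 sz1 blkE.
all: move: blk (size class0) (size (class true true true)) (size (class true true false))
  (size (class true false true)) (size (class false true true)) (size (class true false false))
  (size (class false true false)) (size (class false false true)) #|V|.
all: by clear; lia.
Qed.

End PlanOfQuotient.

(** * Cutting a path decomposition into three parts *)

Lemma pathwidth_tripartition (V : finType) (P : sgraph V) (p : nat) :
  is_pathwidth P p ->
  exists part : V -> nat,
    [/\ forall v, (part v <= 3)%N,
        (#|[set v | part v == 0%N]| <= 2 * p + 2)%N,
        forall i, (0 < i <= 3)%N -> (3 * #|[set v | part v == i]| <= #|V|)%N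
      & forall u v, P u v -> [|| part u == 0%N, part v == 0%N | part u == part v]].
Proof.
move=> [[bags [cov edg itv] wd] _].
(* Past the last bag [B] is empty, so [size bags] can serve as a witness below even if there are no
   bags. *)
pose B i := nth finset.set0 bags i.
have cardB i : (#|B i| <= p.+1)%N.
  rewrite /B; case: (ltnP i (size bags)) => li; last by rewrite nth_default // cards0.
  have : (#|nth finset.set0 bags i| <= \max_(X <- bags) #|X|)%N.
    by apply: leq_bigmax_seq => //; exact: mem_nth.
  by move: wd; rewrite /pd_width; lia.
(* The vertices seen strictly before bag [i]. *)
pose U i := \bigcup_(j < i) B j.
have UP v i : reflect (exists2 j, (j < i)%N & v \in B j) (v \in U i).
  apply: (iffP bigcupP) => [[j _ vj]|[j ji vj]]; first by exists j.
  by exists (Ordinal ji).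
have Umono i j : (i <= j)%N -> U i \subset U j.
  move=> ij; apply/subsetP => v /UP[l li vl]; apply/UP; exists l => //.
  exact: leq_trans ij.
have US v i : (v \in U i.+1) = (v \in U i) || (v \in B i).
  apply/UP/orP => [[j]|[/UP[j ji vj]|vi]].
  - by rewrite ltnS leq_eqVlt => /orP[/eqP -> ->|ji vj]; [right|left; apply/UP; exists j].
  - by exists j => //; apply: ltnW.
  - by exists i.
have Utop : U (size bags).+1 = [set: V].
  apply/setP => v; rewrite in_setT; apply/UP.
  have [X Xb vX] := cov v; exists (index X bags); last by rewrite /B nth_index.
  by rewrite ltnS ltnW // index_mem.
have U0 : U 0 = finset.set0 by rewrite /U big_ord0.
have exi : exists i, (#|V| <= 3 * #|U i.+1|)%N.
  by exists (size bags); rewrite Utop cardsT; lia.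
have exj : exists j, (2 * #|V| <= 3 * #|U j.+1|)%N.
  by exists (size bags); rewrite Utop cardsT; lia.
(* Bag [i] is the one that brings the union up to a third of the vertices, bag [j] the one that
   reaches two thirds. By minimality the unions before them do not exceed these thresholds. *)
case: (ex_minnP exi) => i iU imin; case: (ex_minnP exj) => j jU jmin.
have Ui : (3 * #|U i| <= #|V|)%N.
  case: (i) imin => [|i'] imin; first by rewrite U0 cards0.
  by rewrite leqNgt; apply/negP => lt; have := imin i' (ltnW lt); rewrite ltnn.
have Uj : (3 * #|U j| <= 2 * #|V|)%N.
  case: (j) jmin => [|j'] jmin; first by rewrite U0 cards0.
  by rewrite leqNgt; apply/negP => lt; have := jmin j' (ltnW lt); rewrite ltnn.
have ij : (i <= j)%N by apply: imin; lia.
pose part v := if v \in B i :|: B j then 0%N else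
  if v \in U i then 1%N else if v \in U j then 2 else 3.
(* The bag shared by [u] and [v] comes after [a], and [u] also occurs before [a]; the bags of [u]
   form an interval, so [u] would lie in bag [a]. *)
have sep a u v : P u v -> u \in U a -> u \notin B a -> v \notin U a.+1 -> False.
  move=> Puv /UP[b ba ub] /negP ua /UP vU; apply: ua.
  have [X Xb /andP[uX vX]] := edg u v Puv.
  have al : (a < index X bags)%N.
    rewrite ltnNge; apply/negP => la; apply: vU; exists (index X bags) => //.
    by rewrite /B nth_index.
  have lt : (index X bags < size bags)%N by rewrite index_mem.
  have /subsetP/(_ u) := itv b a (index X bags) (ltnW ba) (ltnW al) lt.
  by rewrite inE nth_index // => sub; apply: sub; rewrite uX andbT.
have p1 v : part v = 1%N -> [/\ v \in U i & v \notin B i].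
  rewrite /part inE; case: (v \in B i); case: (v \in B j) => //=.
  by case: (v \in U i) => //; case: ifP.
have p2 v : part v = 2 -> [/\ v \in U j, v \notin B j & v \notin U i.+1].
  rewrite /part inE US; case: (v \in B i); case: (v \in B j) => //=.
  by case: (v \in U i) => //; case: ifP.
have p3 v : part v = 3 -> v \notin U i.+1 /\ v \notin U j.+1.
  rewrite /part inE !US; case: (v \in B i); case: (v \in B j) => //=.
  by case: (v \in U i) => //; case: ifP.
have part_le v : (part v <= 3)%N by rewrite /part; do 3!case: ifP => // _.
have part_lt u v : P u v -> (0 < part u < part v)%N -> False.
  move=> Puv; have := part_le v; have := p1 u; have := p2 u; have := p2 v; have := p3 v.
  case: (part u) => [|[|[|[|pu]]]]; case: (part v) => [|[|[|[|pv]]]] //= H3 H2 G2 H1 le lt.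
  - by have [u1 u2] := H1 erefl; have [_ _ v1] := H2 erefl; exact: sep Puv u1 u2 v1.
  - by have [u1 u2] := H1 erefl; have [v1 _] := H3 erefl; exact: sep Puv u1 u2 v1.
  - by have [u1 u2 _] := G2 erefl; have [_ v1] := H3 erefl; exact: sep Puv u1 u2 v1.
exists part; split=> //.
- apply: (@leq_trans #|B i :|: B j|).
    by apply/subset_leq_card/subsetP => v; rewrite inE /part; do 3?case: ifP => //.
  rewrite cardsU; have := cardB i; have := cardB j; lia.
- case=> [|[|[|[|]]]] // _.
  + apply: leq_trans Ui; rewrite leq_mul2l /=.
    by apply/subset_leq_card/subsetP => v; rewrite inE => /eqP /p1[].
  + apply: (@leq_trans (3 * #|U j :\: U i.+1|)).
      rewrite leq_mul2l /=; apply/subset_leq_card/subsetP => v.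
      by rewrite !inE => /eqP /p2[-> _ ->].
    (* For i < j the middle part lies between the two thresholds, which differ by a third; if the
       cuts coincide it is empty. *)
    have [lij|ji] := ltnP i j.
      by rewrite cardsD (setIidPr (Umono _ _ lij)); lia.
    have /eqP -> : U j :\: U i.+1 == finset.set0.
      by rewrite setD_eq0; apply: Umono; lia.
    by rewrite cards0.
  + apply: (@leq_trans (3 * #|~: U j.+1|)).
      rewrite leq_mul2l /=; apply/subset_leq_card/subsetP => v.
      by rewrite !inE => /eqP /p3[].
    have := cardsC (U j.+1); move: jU; lia.
- move=> u v Puv; case: (eqVneq (part u) 0%N) => //= u0.
  case: (eqVneq (part v) 0%N) => //= v0.
  case: (ltngtP (part u) (part v)) => // lt; exfalso.
    by apply: (part_lt u v Puv); rewrite lt0n u0.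
  by apply: (part_lt v u); rewrite ?lt0n ?v0 // adj_sym.
Qed.

(** * Runs of the word RAM *)

Fixpoint wregs (c : cmd) : seq nat :=
  match c with
  | Skip | ArrSet _ _ _ => [::]
  | Const r _ | Op _ r _ _ | ArrGet r _ _ => [:: r]
  | Seq c1 c2 | IfPos _ c1 c2 => wregs c1 ++ wregs c2
  | WhilePos _ c1 => wregs c1
  end.

Fixpoint warrs (c : cmd) : seq nat :=
  match c with
  | ArrSet a _ _ => [:: a]
  | Seq c1 c2 | IfPos _ c1 c2 => warrs c1 ++ warrs c2
  | WhilePos _ c1 => warrs c1
  | _ => [::]
  end.

(** This applies to the unknown multiplication program as well: tables and images of pattern
    vertices survive a call because its text does not write them. *)
Lemma exec_frame W c s t s' : exec W c s t s' ->
  (forall r, r \notin wregs c -> reg s' r = reg s r) /\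
  (forall a i, a \notin warrs c -> arr s' a i = arr s a i).
Proof.
elim=> {c s t s'} /=.
- by [].
- by move=> s r z _; split=> // r'; rewrite inE => /negPf ->.
- by move=> s o r x y _; split=> // r'; rewrite inE => /negPf ->.
- by move=> s r a x i _ _; split=> // r'; rewrite inE => /negPf ->.
- by move=> s a x y i _ _; split=> // a' i'; rewrite inE => /negPf ->.
- move=> c1 c2 s1 s2 s3 t1 t2 _ [H1 H2] _ [H3 H4].
  by split=> [r|a i]; rewrite mem_cat negb_or => /andP[? ?]; rewrite ?H3 ?H1 ?H4 ?H2.
- move=> r c1 c2 s s' t _ _ [H1 H2].
  by split=> [x|a i]; rewrite mem_cat negb_or => /andP[? ?]; rewrite ?H1 ?H2.
- move=> r c1 c2 s s' t _ _ [H1 H2].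
  by split=> [x|a i]; rewrite mem_cat negb_or => /andP[? ?]; rewrite ?H1 ?H2.
- by [].
- move=> r c s1 s2 s3 t1 t2 _ _ [H1 H2] _ [H3 H4].
  by split=> [x|a i] H; rewrite ?H3 ?H1 ?H4 ?H2.
Qed.

(** Specifications such as [ram_mulmx] start from a state that fits, so this property is carried
    through every run. *)
Lemma exec_fits W c s t s' : exec W c s t s' -> fits W s -> fits W s'.
Proof.
elim=> {c s t s'} //=.
- by move=> s r z zW [f1 f2]; split=> // r' /=; case: eqP.
- by move=> s o r x y zW [f1 f2]; split=> // r' /=; case: eqP.
- by move=> s r a x i _ zW [f1 f2]; split=> // r' /=; case: eqP.
- by move=> s a x y i _ zW [f1 f2]; split=> // a' i' /=; case: ifP.
- by move=> c1 c2 s1 s2 s3 t1 t2 _ H1 _ H2 /H1.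
- by move=> r c s1 s2 s3 t1 t2 _ _ H1 _ H2 /H1.
Qed.

Definition runs (W : nat) (c : cmd) (s : state) (t : nat) (Q : state -> Prop) : Prop :=
  exists t' s', [/\ exec W c s t' s', (t' <= t)%N & Q s'].

Lemma runs_mono W c s t t' (Q Q' : state -> Prop) : (t <= t')%N ->
  (forall s', Q s' -> Q' s') -> runs W c s t Q -> runs W c s t' Q'.
Proof.
move=> tt QQ [u [s' [ex ut /QQ q]]]; exists u, s'; split=> //.
exact: leq_trans tt.
Qed.

Lemma runs_frame W c s t (Q : state -> Prop) : fits W s -> runs W c s t Q ->
  runs W c s t (fun s' => [/\ Q s', fits W s',
    forall r, r \notin wregs c -> reg s' r = reg s r &
    forall a i, a \notin warrs c -> arr s' a i = arr s a i]).
Proof.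
move=> fs [u [s' [ex ut q]]]; exists u, s'; split=> //.
have [H1 H2] := exec_frame ex; split=> //; exact: exec_fits ex fs.
Qed.

Lemma runs_seq W c1 c2 s t1 t2 (Q : state -> Prop) :
  runs W c1 s t1 (fun s' => runs W c2 s' t2 Q) -> runs W (Seq c1 c2) s (t1 + t2) Q.
Proof.
move=> [u1 [s1 [e1 l1 [u2 [s2 [e2 l2 q]]]]]]; exists (u1 + u2)%N, s2; split=> //.
- exact: exec_seq e1 e2.
- exact: leq_add.
Qed.

Lemma runs_const W s r z (Q : state -> Prop) : (`|z| <= W)%N ->
  Q (set_reg s r z) -> runs W (Const r z) s 1 Q.
Proof. by move=> zW q; exists 1%N, (set_reg s r z); split=> //; constructor. Qed.

Lemma runs_op W s o r x y (Q : state -> Prop) :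
  (`|eval_op o (reg s x) (reg s y)| <= W)%N ->
  Q (set_reg s r (eval_op o (reg s x) (reg s y))) -> runs W (Op o r x y) s 1 Q.
Proof. by move=> zW q; do 2!eexists; split; [constructor| |exact: q]. Qed.

Lemma runs_get W s r a x (i : nat) (Q : state -> Prop) :
  fits W s -> reg s x = i -> Q (set_reg s r (arr s a i)) ->
  runs W (ArrGet r a x) s 1 Q.
Proof.
by move=> [_ f2] xi q; do 2!eexists; split; [apply: exec_get xi _; exact: f2| |].
Qed.

Lemma runs_set W s a x y (i : nat) (Q : state -> Prop) :
  fits W s -> reg s x = i -> Q (set_arr s a i (reg s y)) ->
  runs W (ArrSet a x y) s 1 Q.
Proof.
by move=> [f1 _] xi q; do 2!eexists; split; [apply: exec_set xi _; exact: f1| |].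
Qed.

(* The loop variable [v] takes the values [reg b - 1, ..., 0]; [one] holds 1. *)
Definition for_ (v b one : nat) (body : cmd) : cmd :=
  Seq (Op OMul v b one) (WhilePos v (Seq (Op OSub v v one) body)).

(** [J i] holds with [i] iterations left. [Jset] is required because the loop itself copies and
    decrements [v] outside the body. Each iteration pays for a test and a decrement besides the
    body; the initial copy and the last test make the 2. *)
Lemma runs_for W v b one body (m : nat) tb (J : nat -> state -> Prop) s :
  v != one -> fits W s -> reg s b = m -> J m s ->
  (forall i s1, J i s1 -> reg s1 one = 1) ->
  (forall i s1 x, J i s1 -> J i (set_reg s1 v x)) ->
  (forall i s1, (i < m)%N -> fits W s1 -> J i.+1 s1 -> reg s1 v = i ->
    runs W body s1 tb (fun s2 => J i s2 /\ reg s2 v = i)) ->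
  runs W (for_ v b one body) s (2 + m * (tb + 2))
    (fun s2 => J 0%N s2 /\ reg s2 v = 0).
Proof.
move=> vone fs bm Jm J1 Jset step.
have mW : (m <= W)%N by case: fs => /(_ b); rewrite bm.
have loop i : (i <= m)%N -> forall s1, fits W s1 -> J i s1 -> reg s1 v = i ->
    runs W (WhilePos v (Seq (Op OSub v v one) body)) s1 (1 + i * (tb + 2))
      (fun s2 => J 0%N s2 /\ reg s2 v = 0).
  elim: i => [|i IH] im s1 fs1 Ji vi.
    by exists 1%N, s1; split=> //; constructor; rewrite vi.
  have E : eval_op OSub (reg s1 v) (reg s1 one) = i.
    by rewrite /= vi (J1 _ _ Ji); lia.
  have : runs W (Seq (Op OSub v v one) body) s1 (1 + tb)
      (fun s2 => J i s2 /\ reg s2 v = i).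
    apply: runs_seq; apply: runs_op; rewrite E; first by lia.
    apply: step => //; last 2 first; [exact: Jset | by rewrite /= eqxx | ].
    by case: fs1 => f1 f2; split=> // r /=; case: eqP => // _; lia.
  case=> [u [s2 [e2 l2 [Ji2 vi2]]]].
  have [u3 [s3 [e3 l3 q3]]] := IH (ltnW im) s2 (exec_fits e2 fs1) Ji2 vi2.
  exists (u + u3).+1, s3; split=> //; first by apply: exec_while_step e2 e3; rewrite vi.
  by lia.
apply: (@runs_mono _ _ _ (1 + (1 + m * (tb + 2))) _ (fun s2 => J 0%N s2 /\ reg s2 v = 0)) => //.
have E : eval_op OMul (reg s b) (reg s one) = m by rewrite /= bm (J1 _ _ Jm); lia.
apply: runs_seq; apply: runs_op; rewrite E //.
apply: loop => //; last by rewrite /= eqxx.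
  by case: fs => f1 f2; split=> // r /=; case: eqP.
exact: Jset.
Qed.

Lemma all2_cat (T : Type) (r : T -> T -> bool) s1 s2 t1 t2 :
  size s1 = size t1 -> all2 r (s1 ++ s2) (t1 ++ t2) = all2 r s1 t1 && all2 r s2 t2.
Proof. by elim: s1 t1 => [|x s1 IH] [|y t1] //= [/IH ->]; rewrite andbA. Qed.

Section Programs.

Variables (K k n : nat).

Local Notation env := {ffun 'I_k -> 'I_n}.

(* Registers and arrays below [K] are left to the matrix multiplication program,
   which uses arrays 0, 1 and 2 for its operands and its result. Above, array
   [K] holds the host graph and arrays [K + 1] to [K + 3] the tables; register
   [K] holds [n], register [K + 1] the constant 1, registers [K + 2] to [K + 9]
   are temporaries, and [var v] is the image of the pattern vertex [v]. *)
Definition rN := K.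
Definition rOne := K.+1.
Definition var (v : 'I_k) : nat := (K + 10 + v)%N.

Definition temp (r : nat) : bool := (K.+2 <= r < K + 10)%N.

Definition env_in (s : state) (e : env) : Prop :=
  [/\ reg s rN = n, reg s rOne = 1 & forall v, reg s (var v) = e v].

Lemma env_in_set s e r x : (r < K)%N || temp r -> env_in s e -> env_in (set_reg s r x) e.
Proof.
rewrite /temp => rt [e1 e2 e3]; split=> [| |v] /=.
- by case: eqP => // E; move: rt; rewrite -E /rN; lia.
- by case: eqP => // E; move: rt; rewrite -E /rOne; lia.
- by case: eqP => // E; move: rt; rewrite -E /var; lia.
Qed.

Lemma env_in_set_arr s e a i x : env_in s e -> env_in (set_arr s a i x) e.
Proof. by []. Qed.

Lemma env_in_frame s s' e c : env_in s e ->
  {subset wregs c <= [pred r | (r < K)%N || temp r]} ->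
  (forall r, r \notin wregs c -> reg s' r = reg s r) -> env_in s' e.
Proof.
move=> [e1 e2 e3] sub fr; split=> [| |v]; rewrite fr //.
- by apply/negP => /sub; rewrite inE /temp /rN; lia.
- by apply/negP => /sub; rewrite inE /temp /rOne; lia.
- by apply/negP => /sub; rewrite inE /temp /var; lia.
Qed.

Definition loops (L : seq 'I_k) (body : cmd) : cmd :=
  foldr (fun v => for_ (var v) rN rOne) body L.

Fixpoint ltime (l tb : nat) : nat :=
  if l is l'.+1 then (2 + n * (ltime l' tb + 2))%N else tb.

Lemma all2_agree_refl BV (s : seq env) : all2 (agree BV) s s.
Proof. by elim: s => //= e s ->; rewrite agree_refl. Qed.

Lemma envs_agree L BV (e f : env) : agree (L ++ BV) e f ->
  all2 (agree BV) (envs L e) (envs L f).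
Proof.
elim: L e f => [|v L IH] e f ef /=; first by rewrite ef.
elim: (rev _) => //= i s IHs; rewrite all2_cat ?IHs ?size_envs // andbT.
apply: IH; apply/agreeP => u uL; rewrite !ffunE; case: eqP => // /eqP uv.
by move/agreeP: ef; apply; rewrite inE negb_or uv.
Qed.

Lemma mem_envsE L (e f : env) : (f \in envs L e) = agree L e f.
Proof.
apply/idP/idP => [/mem_envs //|].
elim: L e => [|v L IH] e /= ef.
  by rewrite inE; apply/eqP/ffunP => v; move/agreeP: ef => ->.
apply/flatten_mapP; exists (f v); first by rewrite mem_rev mem_enum.
apply: IH; apply/agreeP => u uL; rewrite ffunE; case: eqP => [-> //|/eqP uv].
by move/agreeP: ef; apply; rewrite inE negb_or uv.
Qed.

(** [Phi] speaks of the list of environments processed so far. The body may overwrite the images of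
    [BV], so these environments are known only up to [BV], and [Phi] must respect that. [Mx] bounds
    the length of the list, from which bounds on partial sums follow. *)
Lemma runs_loops W body tb BV X e0 (Phi : seq env -> state -> Prop) (Mx : nat) :
  (forall done s v x, Phi done s -> Phi done (set_reg s (var v) x)) ->
  (forall d1 d2 s, all2 (agree BV) d1 d2 -> Phi d1 s -> Phi d2 s) ->
  {subset BV <= X} ->
  (forall done s e, (size done < Mx)%N -> fits W s -> env_in s e -> agree X e0 e ->
     Phi done s -> runs W body s tb (fun s' =>
       exists e', [/\ env_in s' e', agree BV e e' & Phi (rcons done e) s'])) ->
  forall L done s e, uniq L -> {in L, forall v, v \notin BV} -> {subset L <= X} ->
    (size done + n ^ size L <= Mx)%N -> fits W s -> env_in s e -> agree X e0 e ->
    Phi done s -> runs W (loops L body) s (ltime (size L) tb) (fun s' =>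
       exists e', [/\ env_in s' e', agree (L ++ BV) e e' & Phi (done ++ envs L e) s']).
Proof.
move=> Pset Pext BX step; elim=> [|v L IH] done s e /=.
  move=> _ _ _; rewrite addn1 => dM fs es e0e Ps.
  by rewrite cats1; exact: step.
move=> /andP[vL uL] LB LX sz fs es e0e Ps.
have LB' : {in L, forall v, v \notin BV} by move=> u uL'; apply: LB; rewrite inE uL' orbT.
have LX' : {subset L <= X} by move=> u uL'; apply: LX; rewrite inE uL' orbT.
have vB : v \notin BV by apply: LB; rewrite mem_head.
(* With [i] iterations left, the values of [v] already treated are those at least [i], the largest
   first. *)
pose proc i := flatten [seq envs L (upd e v j) | j <- rev (drop i (enum 'I_n))].
have size_proc i : size (proc i) = ((n - i) * n ^ size L)%N.
  rewrite /proc; have -> : (n - i)%N = size (rev (drop i (enum 'I_n))).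
    by rewrite size_rev size_drop size_enum_ord.
  by elim: (rev _) => //= j r IHr; rewrite size_cat size_envs IHr mulSn.
(* The register of [v] is left out, since the loop overwrites it; the inner variables hold whatever
   the previous iteration left. *)
pose J i s1 := exists2 e1, agree (v :: L ++ BV) e e1 &
  [/\ reg s1 rN = n, reg s1 rOne = 1,
   forall u, u != v -> reg s1 (var u) = e1 u & Phi (done ++ proc i) s1].
have var_inj u w : (var u == var w) = (u == w).
  by apply/eqP/eqP => [|-> //]; rewrite /var => E; apply: val_inj => /=; lia.
have v1 : var v != rOne by rewrite /var /rOne; lia.
have vN : rN != var v by rewrite /var /rN; lia.
apply: (@runs_mono _ _ _ (2 + n * (ltime (size L) tb + 2)) _
  (fun s2 => J 0%N s2 /\ reg s2 (var v) = 0)) => //.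
  move=> s' [[e1 ee1 [s1 s2 s3 P']] v0].
  (* The loop ends with 0 in the register of [v]. This is again a host vertex because [e v] shows
     that there is one. *)
  have n0 : (0 < n)%N by have := ltn_ord (e v); lia.
  exists (upd e1 v (Ordinal n0)); split.
  - split=> // u; rewrite ffunE; case: eqP => [-> //|/eqP uv]; exact: s3.
  - apply: agree_trans ee1 _; apply: (agree_sub _ (agree_updr _ _ _)).
    by move=> u; rewrite mem_seq1 => /eqP ->; rewrite mem_head.
  - by move: P'; rewrite /proc drop0.
apply: runs_for => //.
- by case: es.
- exists e; first exact: agree_refl.
  case: es => E1 E2 E3; split=> //.
  by rewrite /proc drop_oversize ?size_enum_ord // cats0.
- by move=> i s1 [e1 _ []].
- move=> i s1 x [e1 ee1 [E1 E2 E3 P1]]; exists e1 => //.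
  split; last exact: Pset.
  + by rewrite /= (negPf vN).
  + by rewrite /= eq_sym (negPf v1).
  + by move=> u uv /=; rewrite var_inj (negPf uv) E3.
move=> i s1 lt_in fs1 [e1 ee1 [E1 E2 E3 P1]] vi.
pose io := Ordinal lt_in.
have es1 : env_in s1 (upd e1 v io).
  split=> // u; rewrite ffunE; case: eqP => [-> //|/eqP uv]; exact: E3.
have sub1 : {subset v :: L ++ BV <= X}.
  move=> u; rewrite inE mem_cat => /or3P[/eqP ->|/LX'|/BX] //.
  by apply: LX; rewrite mem_head.
have agX : agree X e0 (upd e1 v io).
  apply: agree_trans e0e _; apply: agree_trans (agree_sub sub1 ee1) _.
  apply: (agree_sub _ (agree_updr _ _ _)) => u; rewrite mem_seq1 => /eqP ->.
  by apply: LX; rewrite mem_head.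
have szi : (size (done ++ proc i.+1) + n ^ size L <= Mx)%N.
  apply: leq_trans sz; rewrite size_cat size_proc -addnA leq_add2l expnS.
  by rewrite -mulSnr leq_mul2r; apply/orP; right; lia.
have := IH _ _ _ uL LB' LX' szi fs1 es1 agX P1.
apply: runs_mono => // s2 [e2 [es2 a2 P2]]; split; last first.
  case: es2 => _ _ ->; move/agreeP: a2 => ->; first by rewrite ffunE eqxx.
  by rewrite mem_cat negb_or vL.
exists e2.
  apply: agree_trans ee1 _; apply: (@agree_trans _ _ _ _ (upd e1 v io)).
    apply: (agree_sub _ (agree_updr _ _ _)) => u; rewrite mem_seq1 => /eqP ->.
    by rewrite mem_head.
  by apply: agree_sub a2 => u uLB; rewrite inE uLB orbT.
case: es2 => F1 F2 F3; split=> //.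
apply: Pext P2.
have -> : proc i = proc i.+1 ++ envs L (upd e v io).
  rewrite /proc (drop_nth io) ?size_enum_ord // rev_cons map_rcons flatten_rcons.
  by rewrite (_ : nth _ _ _ = io) //; apply: val_inj; rewrite /= nth_enum_ord.
rewrite catA all2_cat // all2_agree_refl /=.
apply: envs_agree; rewrite agree_sym.
apply/agreeP => u uLB; rewrite !ffunE; case: eqP => // /eqP uv.
by move/agreeP: ee1; apply; rewrite inE negb_or uv.
Qed.

End Programs.

(** * Loops over assignments *)

(** Such an [I] depends neither on registers nor on the arrays in [A]. *)
Definition arr_inv (I : state -> Prop) (A : seq nat) : Prop :=
  forall s s', (forall a i, a \notin A -> arr s' a i = arr s a i) -> I s -> I s'.

Section Programs.

Variables (K k n W : nat).

Local Notation env := {ffun 'I_k -> 'I_n}.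
Local Notation var := (@var K k).
Local Notation loops := (@loops K k).
Local Notation ltime := (ltime n).
Local Notation env_in := (@env_in K k n).

Definition scratch (r : nat) : bool := (r < K)%N || temp K r.

(* [BV] lists the pattern vertices whose images [c] may overwrite. *)
Definition does (I : state -> Prop) (D : env -> Prop) (c : cmd) (BV : seq 'I_k)
    (Q : env -> state -> Prop) (t : nat) : Prop :=
  forall s e, fits W s -> env_in s e -> D e -> I s ->
    runs W c s t (fun s' => exists e', [/\ env_in s' e', agree BV e e' & Q e s']).

Definition computes I D c r BV (F : env -> int) t : Prop :=
  does I D c BV (fun e s' => reg s' r = F e) t.

Definition closed_under (X : seq 'I_k) (D : env -> Prop) : Prop :=
  forall e e', agree X e e' -> D e -> D e'.

Lemma arr_inv_reg I A s r x : arr_inv I A -> I s -> I (set_reg s r x).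
Proof. by move=> H; apply: H => a i _. Qed.

Lemma arr_inv_sub I A A' : {subset A' <= A} -> arr_inv I A -> arr_inv I A'.
Proof.
move=> sub H s s' eqA; apply: H => a i aA; apply: eqA.
by apply: contra aA => /sub.
Qed.

Lemma scratch_var r v : scratch r -> (r == var v) = false.
Proof. by rewrite /scratch /temp /var; lia. Qed.

Lemma wregs_loops r L body : scratch r -> (r \in wregs (loops L body)) = (r \in wregs body).
Proof.
move=> rf; elim: L => //= v L IH.
by rewrite !inE !(scratch_var _ rf) /=.
Qed.

Lemma warrs_loops L body : warrs (loops L body) = warrs body.
Proof. by elim: L. Qed.

Definition sumloop (acc r : nat) (L : seq 'I_k) (body : cmd) : cmd :=
  Seq (Const acc 0) (loops L (Seq body (Op OAdd acc acc r))).

Lemma sumloop_computes I D body acc r L BV F B tb :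
  computes I D body r BV F tb -> arr_inv I (warrs body) ->
  acc \notin wregs body -> scratch acc -> indep BV F ->
  (forall f, `|F f| <= B)%N -> (n ^ size L * B <= W)%N ->
  uniq L -> {in L, forall v, v \notin BV} -> closed_under (L ++ BV) D ->
  computes I D (sumloop acc r L body) acc (L ++ BV) (sumL L F)
    (1 + ltime (size L) (tb + 1)).
Proof.
move=> Hb HI accb facc iF FB nB uL LB HD s e fs es De Is.
apply: runs_seq; apply: runs_const => //.
pose Phi (done : seq env) s1 := I s1 /\ reg s1 acc = \sum_(f <- done) F f.
(* Every partial sum has to fit in a word. *)
have sum_le (d : seq env) : (size d <= n ^ size L)%N -> (`|(\sum_(f <- d) F f)%R| <= W)%N.
  move=> dL; apply: leq_trans nB.
  apply: (@leq_trans (size d * B)%N); last by rewrite leq_mul2r dL orbT.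
  elim: d {dL} => [|f d IH]; first by rewrite big_nil.
  by rewrite big_cons mulSn; apply: leq_trans (leq_absD _ _) (leq_add (FB f) IH).
have := @runs_loops K k n W (Seq body (Op OAdd acc acc r)) (tb + 1) BV (L ++ BV) e
  Phi (n ^ size L)%N.
move=> H; apply: (runs_mono (leqnn _)) (H _ _ _ _ L [::] _ e _ _ _ _ _ _ _ _) => {H} //.
- by move=> s' [e' [es' ee' [_ E]]]; exists e'.
- move=> done s1 v x [I1 E]; split; first exact: arr_inv_reg HI I1.
  by rewrite /= (scratch_var _ facc).
- move=> d1 d2 s1 A [I1 E]; split=> //; rewrite E.
  elim: d1 d2 A {E} => [|f1 d1 IH] [|f2 d2] //= /andP[/iF E /IH].
  by rewrite !big_cons E => ->.
- by move=> v vB; rewrite mem_cat vB orbT.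
- move=> done s1 e1 sd fs1 es1 ee1 [I1 E].
  apply: runs_seq.
  have := runs_frame fs1 (Hb s1 e1 fs1 es1 (HD _ _ ee1 De) I1).
  apply: (runs_mono (leqnn _)) => s2 [[e2 [es2 ee2 r2]] fs2 fr2 fa2].
  have V : eval_op OAdd (reg s2 acc) (reg s2 r) = \sum_(f <- rcons done e1) F f.
    by rewrite /= fr2 // E r2 big_rcons /= addrC.
  apply: runs_op; rewrite V; first by apply: sum_le; rewrite size_rcons.
  exists e2; split=> //; first exact: env_in_set.
  split; last by rewrite /= eqxx.
  by apply: (arr_inv_reg _ _ HI); exact: HI I1.
- by move=> v vL; rewrite mem_cat vL.
- by case: fs => f1 f2; split=> // r' /=; case: eqP.
- exact: env_in_set.
- exact: agree_refl.
- by split; [exact: arr_inv_reg HI Is | rewrite /= eqxx big_nil].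
Qed.

Fixpoint horner (ri : nat) (L : seq 'I_k) : cmd :=
  if L is v :: L' then
    Seq (Op OMul ri ri (rN K)) (Seq (Op OAdd ri ri (var v)) (horner ri L'))
  else Skip.

Definition idxp (ri : nat) (L : seq 'I_k) : cmd := Seq (Const ri 0) (horner ri L).

Lemma wregs_idxp ri L x : x \in wregs (idxp ri L) -> x = ri.
Proof.
rewrite /idxp /= inE => /orP[/eqP //|].
by elim: L => //= v L IH; rewrite !inE => /orP[/eqP|/orP[/eqP|/IH]].
Qed.

Lemma warrs_idxp ri L : warrs (idxp ri L) = [::].
Proof. by rewrite /idxp /=; elim: L. Qed.

Lemma horner_runs ri L s e (a : nat) : scratch ri -> fits W s -> env_in s e ->
  reg s ri = a -> (a.+1 * n ^ size L <= W)%N ->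
  runs W (horner ri L) s (1 + 2 * size L)
    (fun s' => env_in s' e /\ reg s' ri = foldl (fun b v => b * n + e v)%N a L).
Proof.
move=> fri; elim: L s a => [|v L IH] s a fs es ra aW /=.
  by exists 1%N, s; split=> //; constructor.
have es0 := es; have ev := ltn_ord (e v).
have [E1 E2 E3] := es.
have n0 : (0 < n ^ size L)%N by rewrite expn_gt0; apply/orP; left; lia.
(* With the successor the bound is preserved by a round of Horner's rule, since the digit [e v] is
   less than [n]. *)
have step : ((a * n + e v).+1 * n ^ size L <= W)%N.
  apply: leq_trans aW; rewrite expnS mulnA leq_mul2r; apply/orP; right; nia.
have le1 : (a * n <= W)%N.
  by apply: leq_trans step; apply: (@leq_trans (a * n + e v).+1); [lia|exact: leq_pmulr].
have le2 : (a * n + e v <= W)%N.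
  by apply: leq_trans step; apply: (@leq_trans (a * n + e v).+1); [lia|exact: leq_pmulr].
apply: (@runs_mono _ _ _ (1 + (1 + (1 + 2 * size L))) _ (fun s' => env_in s' e /\
  reg s' ri = foldl (fun b v => b * n + e v)%N (a * n + e v)%N L)) => //; first by lia.
have V1 : eval_op OMul (reg s ri) (reg s (rN K)) = (a * n)%N by rewrite /= ra E1; lia.
apply: runs_seq; apply: runs_op; rewrite V1 //.
have es1 : env_in (set_reg s ri (a * n)%N) e by exact: env_in_set.
have V2 : eval_op OAdd (reg (set_reg s ri (a * n)%N) ri) (reg (set_reg s ri (a * n)%N) (var v))
    = (a * n + e v)%N.
  by rewrite /= eqxx eq_sym (scratch_var _ fri) E3; lia.
apply: runs_seq; apply: runs_op; rewrite V2 //.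
apply: IH => //.
- by case: fs => f1 f2; split=> // r' /=; case: eqP => // _; case: eqP.
- exact: env_in_set.
- by rewrite /= eqxx.
Qed.

Lemma idxp_runs ri L s e : scratch ri -> fits W s -> env_in s e ->
  (n ^ size L <= W)%N ->
  runs W (idxp ri L) s (2 + 2 * size L)
    (fun s' => env_in s' e /\ reg s' ri = idx L e).
Proof.
move=> fri fs es nW; apply: (@runs_mono _ _ _ (1 + (1 + 2 * size L)) _
  (fun s' => env_in s' e /\ reg s' ri = idx L e)) => //.
apply: runs_seq; apply: runs_const => //; apply: horner_runs => //.
- by case: fs => f1 f2; split=> // r' /=; case: eqP.
- exact: env_in_set.
- by rewrite /= eqxx.
- by rewrite mul1n.
Qed.

Definition setloop (a r ri : nat) (L : seq 'I_k) (body : cmd) : cmd :=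
  loops L (Seq body (Seq (idxp ri L) (ArrSet a ri r))).

(** Each entry, once written, stays correct: a later write to the same position comes from an
    environment with the same images of [L], and [F] ignores [BV]. *)
Lemma setloop_does I D body a r ri L BV F tb :
  computes I D body r BV F tb -> arr_inv I (a :: warrs body) ->
  a \notin warrs body -> scratch r -> scratch ri -> ri != r ->
  indep BV F -> (n ^ size L <= W)%N ->
  uniq L -> {in L, forall v, v \notin BV} -> closed_under (L ++ BV) D ->
  does I D (setloop a r ri L body) (L ++ BV)
    (fun e s' => forall f, agree L e f -> arr s' a (idx L f) = F f)
    (ltime (size L) (tb + (3 + 2 * size L))).
Proof.
move=> Hb HI ab fr fri rir iF nW uL LB HD s e fs es De Is.
pose Phi (done : seq env) s1 := [/\ I s1,
  forall f, f \in done -> agree (L ++ BV) e f &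
  forall f, f \in done -> arr s1 a (idx L f) = F f].
have HI' : arr_inv I (warrs body).
  by apply: arr_inv_sub HI => x xb; rewrite inE xb orbT.
have := @runs_loops K k n W (Seq body (Seq (idxp ri L) (ArrSet a ri r)))
  (tb + (3 + 2 * size L)) BV (L ++ BV) e Phi (n ^ size L)%N.
move=> H; apply: (runs_mono (leqnn _)) (H _ _ _ _ L [::] _ e _ _ _ _ _ _ _ _) => {H} //.
- move=> s' [e' [es' ee' [_ _ E]]]; exists e'; split=> // f fe.
  by apply: E; rewrite mem_envsE.
- move=> done s1 v x [I1 E1 E2]; split=> //; exact: arr_inv_reg HI I1.
- move=> d1 d2 s1 A [I1 E1 E2].
  have mem f : f \in d2 -> exists2 g, g \in d1 & agree BV g f.
    elim: d1 d2 A {E1 E2} => [|f1 d1 IH] [|f2 d2] //= /andP[a12 a2].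
    rewrite inE => /orP[/eqP ->|/(IH _ a2) [g gd gf]].
      by exists f1; rewrite ?mem_head.
    by exists g => //; rewrite inE gd orbT.
  split=> // f /mem [g gd gf].
    apply: agree_trans (E1 g gd) (agree_sub _ gf).
    by move=> v vB; rewrite mem_cat vB orbT.
  rewrite (iF g f) // -E2 //; congr (arr _ _ _); apply: eq_idx => v vL.
  by move/agreeP: gf; apply; exact: LB.
- by move=> v vB; rewrite mem_cat vB orbT.
- move=> done s1 e1 sd fs1 es1 ee1 [I1 E1 E2].
  apply: runs_seq.
  have := runs_frame fs1 (Hb s1 e1 fs1 es1 (HD _ _ ee1 De) I1).
  apply: (runs_mono (leqnn _)) => s2 [[e2 [es2 ee2 r2]] fs2 fr2 fa2].
  apply: (@runs_mono _ _ _ (2 + 2 * size L + 1) _ (fun s' => exists e' : env,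
    [/\ env_in s' e', agree BV e1 e' & Phi (rcons done e1) s'])) => //; first by lia.
  apply: runs_seq; have := runs_frame fs2 (idxp_runs fri fs2 es2 nW).
  apply: (runs_mono (leqnn _)) => s3 [[es3 ri3] fs3 fr3 fa3].
  have ix : idx L e2 = idx L e1.
    by apply: eq_idx => v vL; move/agreeP: ee2; apply; exact: LB.
  rewrite ix in ri3.
  have r3 : reg s3 r = F e1.
    by rewrite fr3 //; apply/negP => /wregs_idxp E; rewrite E eqxx in rir.
  have arr3 b i : b \notin warrs body -> arr s3 b i = arr s1 b i.
    by move=> bb; rewrite fa3 ?warrs_idxp // fa2.
  apply: (runs_set fs3 ri3); rewrite r3; exists e2; split=> //; split.
  + apply: HI I1 => b i; rewrite inE negb_or /= => /andP[ba bb].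
    by rewrite (negPf ba) /= arr3.
  + by move=> f; rewrite mem_rcons inE => /orP[/eqP -> //|/E1].
  + move=> f; rewrite mem_rcons inE /= eqxx /=.
    case: (eqVneq (idx L f) (idx L e1)) => [E|E /orP[/eqP Ef|fd]].
    * move=> fd; apply/esym/iF.
      have e0f : agree (L ++ BV) e f by case/orP: fd => [/eqP -> //|/E1].
      apply/agreeP => v vB; have [vL|vL] := boolP (v \in L); first exact: (idx_inj E).
      have vX : v \notin L ++ BV by rewrite mem_cat negb_or vL.
      by move/agreeP: e0f => -> //; move/agreeP: ee1 => ->.
    * by rewrite Ef eqxx in E.
    * by rewrite arr3 // E2.
- by move=> v vL; rewrite mem_cat vL.
- exact: agree_refl.
Qed.

End Programs.

(** * Straight-line programs *)

Section Programs.

Variables (K k n W : nat).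

Local Notation env := {ffun 'I_k -> 'I_n}.
Local Notation var := (@var K k).
Local Notation loops := (@loops K k).
Local Notation ltime := (ltime n).
Local Notation env_in := (@env_in K k n).
Local Notation does := (@does K k n W).
Local Notation computes := (@computes K k n W).

Definition lookup (a r : nat) (L : seq 'I_k) : cmd := Seq (idxp K r L) (ArrGet r a r).

Lemma lookup_computes I D a r L F : scratch K r -> (n ^ size L <= W)%N ->
  arr_inv I [::] -> (forall s e, D e -> I s -> arr s a (idx L e) = F e) ->
  computes I D (lookup a r L) r [::] F (3 + 2 * size L).
Proof.
move=> fr nW HI IF s e fs es De Is.
apply: (@runs_mono _ _ _ (2 + 2 * size L + 1) _ (fun s' => exists e' : env,
  [/\ env_in s' e', agree [::] e e' & reg s' r = F e])) => //; first by lia.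
apply: runs_seq; have := runs_frame fs (idxp_runs fr fs es nW).
apply: (runs_mono (leqnn _)) => s3 [[es3 r3] fs3 _ fa3].
apply: (@runs_get _ _ _ _ _ _ _ fs3 r3); exists e; split; first exact: env_in_set.
  exact: agree_refl.
rewrite /= eqxx -(IF s) //; apply: fa3; by rewrite warrs_idxp.
Qed.

Lemma wregs_lookup a r L x : x \in wregs (lookup a r L) -> x = r.
Proof. by rewrite /= -cat1s catA mem_cat => /orP[/wregs_idxp|]; rewrite ?inE // => /eqP. Qed.

Lemma warrs_lookup a r L : warrs (lookup a r L) = [::].
Proof. by have := warrs_idxp K r L; rewrite /lookup /= => ->. Qed.

Definition mulp (r r2 : nat) (c1 c2 : cmd) : cmd := Seq c1 (Seq c2 (Op OMul r r r2)).

Lemma mulp_computes I D r r2 c1 c2 F1 F2 t1 t2 : scratch K r ->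
  computes I D c1 r [::] F1 t1 -> computes I D c2 r2 [::] F2 t2 ->
  arr_inv I (warrs c1) -> r \notin wregs c2 -> (forall e, `|(F1 e * F2 e)%R| <= W)%N ->
  computes I D (mulp r r2 c1 c2) r [::] (fun e => F1 e * F2 e) (t1 + (t2 + 1)).
Proof.
move=> fr H1 H2 HI rc2 FW s e fs es De Is.
apply: runs_seq; have := runs_frame fs (H1 s e fs es De Is).
apply: (runs_mono (leqnn _)) => s1 [[e1 [es1 ee1 r1]] fs1 _ fa1].
have E1 : e1 = e by apply/ffunP => v; move/agreeP: ee1 => ->.
rewrite {}E1 in es1.
have I1 : I s1 by apply: HI Is => a i; exact: fa1.
apply: runs_seq; have := runs_frame fs1 (H2 s1 e fs1 es1 De I1).
apply: (runs_mono (leqnn _)) => s2 [[e2 [es2 ee2 E2]] fs2 fr2 _].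
have V : eval_op OMul (reg s2 r) (reg s2 r2) = F1 e * F2 e by rewrite /= fr2 // r1 E2.
apply: runs_op; rewrite V //; exists e2; split=> //; first exact: env_in_set.
by rewrite /= eqxx.
Qed.

Lemma warrs_mulp r r2 c1 c2 : warrs (mulp r r2 c1 c2) = warrs c1 ++ warrs c2.
Proof. by rewrite /mulp /= cats0. Qed.

Lemma wregs_mulp r r2 c1 c2 y :
  (y \in wregs (mulp r r2 c1 c2)) = [|| y \in wregs c1, y \in wregs c2 | y == r].
Proof. by rewrite /mulp /= !mem_cat inE. Qed.

Fixpoint edge_tail (r t : nat) (cs : seq ('I_k * 'I_k)) : cmd :=
  if cs is c :: cs' then
    Seq (Op OMul t (var c.1) (rN K)) (Seq (Op OAdd t t (var c.2))
      (Seq (ArrGet t K t) (Seq (Op OMul r r t) (edge_tail r t cs'))))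
  else Skip.

Definition edgep (r t : nat) (cs : seq ('I_k * 'I_k)) : cmd :=
  Seq (Const r 1) (edge_tail r t cs).

Lemma wregs_edgep r t cs x : x \in wregs (edgep r t cs) -> x = r \/ x = t.
Proof.
rewrite /edgep /= inE => /orP[/eqP|]; first by left.
elim: cs => //= c cs IH; rewrite !inE.
by do 4?[case/orP => [/eqP|]]; auto.
Qed.

Lemma warrs_edgep r t cs : warrs (edgep r t cs) = [::].
Proof. by rewrite /edgep /=; elim: cs. Qed.

Lemma edgep_computes I D r t cs (H : rel 'I_n) : scratch K r -> scratch K t -> r != t ->
  (n * n <= W)%N -> (1 <= W)%N -> arr_inv I [::] ->
  (forall s, I s -> forall i j : 'I_n, arr s K (i * n + j)%N = (H i j : nat)) ->
  computes I D (edgep r t cs) r [::] (edge_prod H cs) (2 + 4 * size cs).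
Proof.
move=> fr ft rt nW W1 HI IG s e fs es _ Is.
have fs_set s1 x (z : int) : (`|z| <= W)%N -> fits W s1 -> fits W (set_reg s1 x z).
  by move=> zW [f1 f2]; split=> // r' /=; case: eqP.
have tail (b : bool) s1 : fits W s1 -> env_in s1 e -> I s1 -> reg s1 r = b ->
   runs W (edge_tail r t cs) s1 (1 + 4 * size cs) (fun s' => env_in s' e /\
     reg s' r = (b && all (fun c => H (e c.1) (e c.2)) cs) :> int).
  elim: cs b s1 => [|[u v] cs IH] b s1 fs1 es1 I1 rb /=.
    by exists 1%N, s1; split=> //; [constructor | rewrite andbT].
  have [E1 E2 E3] := es1.
  have un := ltn_ord (e u); have vn := ltn_ord (e v).
  have V1 : eval_op OMul (reg s1 (var u)) (reg s1 (rN K)) = (e u * n)%N.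
    by rewrite /= E3 E1; lia.
  have l1 : (e u * n + e v <= W)%N.
    by apply: leq_trans nW; nia.
  have l0 : (e u * n <= W)%N by lia.
  apply: (@runs_mono _ _ _ (1 + (1 + (1 + (1 + (1 + 4 * size cs))))) _ (fun s' => env_in s' e /\
     reg s' r = (b && (H (e u) (e v) && all (fun c => H (e c.1) (e c.2)) cs)) :> int)) => //.
    by lia.
  apply: runs_seq; apply: runs_op; rewrite V1 //.
  set s2 := set_reg s1 _ _.
  have fs2 : fits W s2 by exact: fs_set.
  have es2 : env_in s2 e by exact: env_in_set.
  have I2 : I s2 by apply: arr_inv_reg HI I1.
  have V2 : eval_op OAdd (reg s2 t) (reg s2 (var v)) = (e u * n + e v)%N.
    by case: es2 => _ _ ->; rewrite /= eqxx; lia.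
  apply: runs_seq; apply: runs_op; rewrite V2 //.
  set s3 := set_reg s2 _ _.
  have fs3 : fits W s3 by exact: fs_set.
  have es3 : env_in s3 e by exact: env_in_set.
  have I3 : I s3 by apply: arr_inv_reg HI I2.
  apply: runs_seq; apply: (@runs_get _ _ _ _ _ (e u * n + e v)%N) => //.
    by rewrite /= eqxx.
  rewrite (IG _ I3); set s4 := set_reg s3 _ _.
  have fs4 : fits W s4 by apply: fs_set => //; case: (H _ _).
  have es4 : env_in s4 e by exact: env_in_set.
  have I4 : I s4 by apply: arr_inv_reg HI I3.
  have V4 : eval_op OMul (reg s4 r) (reg s4 t) = (b && H (e u) (e v)).
    by rewrite /= eqxx (negPf rt) rb; case: (b); case: (H _ _).
  apply: runs_seq; apply: runs_op; rewrite V4; first by case: (_ && _).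
  rewrite andbA; apply: IH.
  - by apply: fs_set => //; case: (_ && _).
  - exact: env_in_set.
  - exact: arr_inv_reg HI I4.
  - by rewrite /= eqxx.
apply: (@runs_mono _ _ _ (1 + (1 + 4 * size cs)) _ (fun s' => env_in s' e /\
  reg s' r = (true && all (fun c => H (e c.1) (e c.2)) cs) :> int)) => //.
  move=> s' [es' E]; exists e; split=> //; first exact: agree_refl.
  by rewrite E edge_prodE /=; case: all.
apply: runs_seq; apply: runs_const => //; apply: tail.
- exact: fs_set.
- exact: env_in_set.
- exact: arr_inv_reg HI Is.
- by rewrite /= eqxx.
Qed.

(** A table filled in one environment is read in another, after variables outside [L] have moved as
    well. This is sound as long as [F] ignores them. *)
Lemma table_extend (L X : seq 'I_k) (F : env -> int) (tab : nat -> int) (e g : env) :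
  (forall f, agree L e f -> tab (idx L f) = F f) -> indep X F ->
  agree (L ++ X) e g -> {in L, forall v, v \notin X} -> tab (idx L g) = F g.
Proof.
move=> tabF iF eg LX.
pose f : env := [ffun v => if v \in L then g v else e v].
have ix : idx L g = idx L f by apply: eq_idx => v vL; rewrite ffunE vL.
rewrite ix tabF; last by apply/agreeP => v vL; rewrite ffunE (negPf vL).
apply: iF; apply/agreeP => v vX; rewrite ffunE; case: ifP => // /negbT vL.
by move/agreeP: eg => ->; rewrite // mem_cat negb_or vL.
Qed.

Lemma table_extend_all (L : seq 'I_k) (F : env -> int) (tab : nat -> int) (e g : env) :
  (forall f, agree L e f -> tab (idx L f) = F f) ->
  indep [seq v <- enum 'I_k | v \notin L] F -> tab (idx L g) = F g.
Proof.
move=> tabF iF; apply: (table_extend tabF iF).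
  by apply/agreeP => v; rewrite mem_cat mem_filter mem_enum andbT orbN.
by move=> v vL; rewrite mem_filter vL.
Qed.

(** Register 0 is where the multiplication program expects the order of its matrices. *)
Fixpoint powp_tail (m : nat) : cmd :=
  if m is m'.+1 then Seq (powp_tail m') (Op OMul 0 0 (rN K)) else Const 0 1.

Lemma powp_runs m s e : (2 < K)%N -> (1 <= W)%N -> (n ^ m <= W)%N -> (0 < n)%N ->
  fits W s -> env_in s e ->
  runs W (powp_tail m) s (1 + m) (fun s' => env_in s' e /\ reg s' 0 = (n ^ m)%N).
Proof.
move=> K2 W1 nW n0 fs es.
have f0 : scratch K 0 by rewrite /scratch (leq_trans _ K2).
elim: m nW => [|m IH] nW /=.
  by apply: runs_const => //; split; [exact: env_in_set | rewrite /= expn0].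
have lem : (n ^ m <= W)%N by apply: leq_trans nW; exact: leq_pexp2l.
apply: (@runs_mono _ _ _ (1 + m + 1) _ (fun s' => env_in s' e /\ reg s' 0 = (n ^ m.+1)%N)) => //.
  by lia.
apply: runs_seq; apply: (runs_mono (leqnn _)) (IH lem) => s1 [es1 r0].
have V : eval_op OMul (reg s1 0) (reg s1 (rN K)) = (n ^ m.+1)%N.
  by case: es1 => E _ _; rewrite /= r0 E expnSr; lia.
by apply: runs_op; rewrite V //; split; [exact: env_in_set | rewrite /= ?eqxx].
Qed.

Lemma wregs_powp m x : x \in wregs (powp_tail m) -> x = 0%N.
Proof.
elim: m => [|m IH] /=; first by rewrite inE => /eqP.
by rewrite mem_cat inE => /orP[/IH|/eqP].
Qed.

Lemma warrs_powp m : warrs (powp_tail m) = [::].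
Proof. by elim: m => //= m ->. Qed.

End Programs.

(** * The program for one quotient *)

Lemma mem_count_le (T : eqType) (v : T) (s : seq T) : ((v \in s) <= count_mem v s)%N.
Proof. by rewrite -has_pred1 has_count; case: (count _ _). Qed.

Lemma warrs_seq c1 c2 : warrs (Seq c1 c2) = warrs c1 ++ warrs c2. Proof. by []. Qed.
Lemma wregs_seq c1 c2 : wregs (Seq c1 c2) = wregs c1 ++ wregs c2. Proof. by []. Qed.

Lemma warrs_sumloop K k acc r (L : seq 'I_k) b :
  warrs (sumloop K acc r L b) = warrs b.
Proof. by rewrite /sumloop /= warrs_loops /= cats0. Qed.

Lemma wregs_sumloop K k acc r (L : seq 'I_k) b x : scratch K x ->
  (x \in wregs (sumloop K acc r L b)) = (x == acc) || (x \in wregs b).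
Proof.
move=> xs; rewrite /sumloop /= inE wregs_loops //= mem_cat inE.
by case: (x == acc) => //=; rewrite orbF.
Qed.

Lemma warrs_setloop K k a r ri (L : seq 'I_k) b :
  warrs (setloop K a r ri L b) = rcons (warrs b) a.
Proof.
have := warrs_idxp K ri L; rewrite /setloop warrs_loops /= => ->.
by rewrite /= cats1.
Qed.

Lemma wregs_setloop K k a r ri (L : seq 'I_k) b x : scratch K x -> x != ri ->
  (x \in wregs (setloop K a r ri L b)) = (x \in wregs b).
Proof.
move=> xs xri; rewrite /setloop wregs_loops //= mem_cat.
case: (x \in wregs b) => //=; apply/negP; rewrite cats0 => H.
by have /eqP := @wregs_idxp K k ri L x H; apply/negP.
Qed.

Definition rAcc (K : nat) := (K + 3)%N.
Definition rIn (K : nat) := (K + 4)%N.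
Definition rV (K : nat) := (K + 5)%N.
Definition rV2 (K : nat) := (K + 6)%N.
Definition rI (K : nat) := (K + 7)%N.
Definition rT (K : nat) := (K + 8)%N.

Lemma size_uniq_ord (k : nat) (L : seq 'I_k) : uniq L -> (size L <= k)%N.
Proof. by move=> uL; have := max_card [in L]; rewrite (card_uniqP uL) card_ord. Qed.

Lemma scratch_rAcc (K : nat) : scratch K (rAcc K). Proof. by rewrite /scratch /temp /rAcc; lia. Qed.
Lemma scratch_rIn (K : nat) : scratch K (rIn K). Proof. by rewrite /scratch /temp /rIn; lia. Qed.
Lemma scratch_rV (K : nat) : scratch K (rV K). Proof. by rewrite /scratch /temp /rV; lia. Qed.
Lemma scratch_rV2 (K : nat) : scratch K (rV2 K). Proof. by rewrite /scratch /temp /rV2; lia. Qed.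
Lemma scratch_rI (K : nat) : scratch K (rI K). Proof. by rewrite /scratch /temp /rI; lia. Qed.
Lemma scratch_rT (K : nat) : scratch K (rT K). Proof. by rewrite /scratch /temp /rT; lia. Qed.
#[local] Hint Resolve scratch_rAcc scratch_rIn scratch_rV scratch_rV2 scratch_rI scratch_rT : core.

(** n^(6k) bounds the accumulator of the outermost sum; the summand 2 covers the positions of the
    adjacency matrix also when k = 0. *)
Lemma pow_le_W (k n W m : nat) : (0 < n)%N -> (n.+2 ^ (6 * k + 2) <= W)%N ->
  (m <= 6 * k + 2)%N -> (n ^ m <= W)%N.
Proof.
move=> n0 W1 mk; apply: leq_trans W1; apply: (@leq_trans (n.+2 ^ m)).
  by case: (m) => // m'; rewrite leq_exp2r //; lia.
exact: leq_pexp2l.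
Qed.

Section PlanProgram.

Variables (K k : nat) (mm : cmd) (x : plan 'I_k).

Local Notation O := (pl_O x).
Local Notation A := (pl_A x).
Local Notation B := (pl_B x).
Local Notation C := (pl_C x).

Definition table_prog (a : nat) (L Lp : seq 'I_k) (cs : seq ('I_k * 'I_k)) : cmd :=
  setloop K a (rIn K) (rI K) L (sumloop K (rIn K) (rV K) Lp (edgep K (rV K) (rT K) cs)).

(** The work for one choice of images of [pl_O]: slices of tables 1 and 3 become the two operands,
    and the product is summed against table 2. Multiplying by [rOne] copies a register. *)
Definition block : cmd :=
  Seq (setloop K 0 (rV K) (rI K) (A ++ B) (lookup K (K + 1) (rV K) (pl_table1 x)))
  (Seq (setloop K 1 (rV K) (rI K) (B ++ C) (lookup K (K + 3) (rV K) (pl_table3 x)))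
  (Seq (powp_tail K (size A))
  (Seq (Op OMul 1 0 (rOne K))
  (Seq mm
  (sumloop K (rIn K) (rV K) (A ++ C)
     (mulp (rV K) (rV2 K) (lookup K 2 (rV K) (A ++ C))
        (lookup K (K + 2) (rV2 K) (pl_table2 x)))))))).

Definition plan_prog : cmd :=
  Seq (table_prog (K + 1) (pl_table1 x) (pl_priv1 x) (pl_edges1 x))
  (Seq (table_prog (K + 2) (pl_table2 x) (pl_priv2 x) (pl_edges2 x))
  (Seq (table_prog (K + 3) (pl_table3 x) (pl_priv3 x) (pl_edges3 x))
  (sumloop K (rAcc K) (rIn K) O block))).

Variables (n W d : nat) (tm : nat -> nat) (H : rel 'I_n).

Local Notation env := {ffun 'I_k -> 'I_n}.
Local Notation ltime := (ltime n).
Local Notation env_in := (@env_in K k n).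
Local Notation does := (@does K k n W).
Local Notation computes := (@computes K k n W).

Definition table_time (l lp c : nat) : nat :=
  ltime l (1 + ltime lp (2 + 4 * c + 1) + (3 + 2 * l)).

Definition block_time : nat :=
  (ltime (size (A ++ B)) (3 + 2 * size (pl_table1 x) + (3 + 2 * size (A ++ B))) +
  (ltime (size (B ++ C)) (3 + 2 * size (pl_table3 x) + (3 + 2 * size (B ++ C))) +
  (1 + size A + (1 + (tm (n ^ size A) +
  (1 + ltime (size (A ++ C)) (3 + 2 * size (A ++ C) +
     (3 + 2 * size (pl_table2 x) + 1) + 1)))))))%N.

Definition plan_time : nat :=
  (table_time (size (pl_table1 x)) (size (pl_priv1 x)) (size (pl_edges1 x)) +
  (table_time (size (pl_table2 x)) (size (pl_priv2 x)) (size (pl_edges2 x)) +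
  (table_time (size (pl_table3 x)) (size (pl_priv3 x)) (size (pl_edges3 x)) +
  (1 + ltime (size O) (block_time + 1)))))%N.

Definition graph_in (s : state) : Prop :=
  forall i j : 'I_n, arr s K (i * n + j)%N = (H i j : nat).

Lemma norm_edge_prod cs (e : env) : (`|edge_prod H cs e| <= 1)%N.
Proof. by rewrite edge_prodE; case: all. Qed.

Definition value1 (e : env) : int := sumL (pl_priv1 x) (edge_prod H (pl_edges1 x)) e.
Definition value2 (e : env) : int := sumL (pl_priv2 x) (edge_prod H (pl_edges2 x)) e.
Definition value3 (e : env) : int := sumL (pl_priv3 x) (edge_prod H (pl_edges3 x)) e.
Definition value13 (e : env) : int := sumL B (fun f => value1 f * value3 f) e.
Definition block_value (e : env) : int := sumL (A ++ C) (fun f => value13 f * value2 f) e.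

Definition tables_in (s : state) : Prop :=
  [/\ graph_in s,
      forall g : env, arr s (K + 1)%N (idx (pl_table1 x) g) = value1 g,
      forall g : env, arr s (K + 2)%N (idx (pl_table2 x) g) = value2 g
    & forall g : env, arr s (K + 3)%N (idx (pl_table3 x) g) = value3 g].

Hypothesis x_ok : plan_ok x.

(** Disjointness of all seven lists in one inequality, so that a membership conflict is refuted by
    case analysis. *)
Lemma plan_disjoint v : ((v \in O) + (v \in A) + (v \in C) + (v \in B) +
  (v \in pl_priv1 x) + (v \in pl_priv3 x) + (v \in pl_priv2 x) <= 1)%N.
Proof.
have := leq_b1 (v \in plan_vars x); rewrite -(count_uniq_mem v (ok_uniq x_ok)).
rewrite /plan_vars !count_cat.
have := mem_count_le v O; have := mem_count_le v A; have := mem_count_le v B.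
have := mem_count_le v C; have := mem_count_le v (pl_priv1 x).
have := mem_count_le v (pl_priv2 x); have := mem_count_le v (pl_priv3 x).
lia.
Qed.

Lemma uniq_part (s : seq 'I_k) : (forall a, count a s <= count a (plan_vars x))%N -> uniq s.
Proof. exact/uniq_leq_count/(ok_uniq x_ok). Qed.

Lemma mem_table1 v : v \in pl_table1 x -> (v \in O) || (v \in A) || (v \in B).
Proof. by move/(ok_sub1 x_ok); rewrite !mem_cat orbA. Qed.
Lemma mem_table2 v : v \in pl_table2 x -> (v \in O) || (v \in A) || (v \in C).
Proof. by move/(ok_sub2 x_ok); rewrite !mem_cat orbA. Qed.
Lemma mem_table3 v : v \in pl_table3 x -> (v \in O) || (v \in B) || (v \in C).
Proof. by move/(ok_sub3 x_ok); rewrite !mem_cat orbA. Qed.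

Lemma edge_prod_indep_within X L cs : within L cs -> (forall v, v \in L -> v \notin X) ->
  indep X (edge_prod H cs : env -> int).
Proof.
move=> wcs LX; apply: edge_prod_indep => c /(allP wcs) /andP[c1 c2].
by rewrite !LX.
Qed.

Lemma value1_indep X : (forall v, v \in X -> (v \in C) || (v \in pl_priv2 x) || (v \in pl_priv3 x)) ->
  indep X value1.
Proof.
move=> HX; apply: indep_sumL; apply: edge_prod_indep_within (ok_edges1 x_ok) _.
move=> v vL; apply/negP => /HX vX; have := plan_disjoint v.
by move: vL vX; rewrite mem_cat => /orP[/mem_table1|];
  do ![case: (v \in _) => //=].
Qed.

Lemma value3_indep X : (forall v, v \in X -> (v \in A) || (v \in pl_priv2 x) || (v \in pl_priv1 x)) ->
  indep X value3.
Proof.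
move=> HX; apply: indep_sumL; apply: edge_prod_indep_within (ok_edges3 x_ok) _.
move=> v vL; apply/negP => /HX vX; have := plan_disjoint v.
by move: vL vX; rewrite mem_cat => /orP[/mem_table3|];
  do ![case: (v \in _) => //=].
Qed.

Lemma value2_indep X : (forall v, v \in X -> (v \in B) || (v \in pl_priv1 x) || (v \in pl_priv3 x)) ->
  indep X value2.
Proof.
move=> HX; apply: indep_sumL; apply: edge_prod_indep_within (ok_edges2 x_ok) _.
move=> v vL; apply/negP => /HX vX; have := plan_disjoint v.
by move: vL vX; rewrite mem_cat => /orP[/mem_table2|];
  do ![case: (v \in _) => //=].
Qed.

(** Running [block] overwrites the images of [A], [B] and [C]; the surrounding sum over [O]
    therefore needs a value that ignores them. *)
Lemma block_value_indep : indep (A ++ B ++ C) block_value.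
Proof.
apply: (@indep_sub _ _ _ ((A ++ C) ++ B)).
  by move=> v; rewrite !mem_cat => /or3P[] ->; rewrite ?orbT.
apply: indep_cat; first exact: indep_sumL_self.
apply: indep_sumL; apply: indep_mul; first exact: indep_sumL_self.
by apply: value2_indep => v ->.
Qed.

Lemma uniq_priv1 : uniq (pl_priv1 x). Proof. by apply: uniq_part => a; rewrite !count_cat; lia. Qed.
Lemma uniq_priv2 : uniq (pl_priv2 x). Proof. by apply: uniq_part => a; rewrite !count_cat; lia. Qed.
Lemma uniq_priv3 : uniq (pl_priv3 x). Proof. by apply: uniq_part => a; rewrite !count_cat; lia. Qed.
Lemma uniq_AB : uniq (A ++ B). Proof. by apply: uniq_part => a; rewrite !count_cat; lia. Qed.
Lemma uniq_BC : uniq (B ++ C). Proof. by apply: uniq_part => a; rewrite !count_cat; lia. Qed.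
Lemma uniq_AC : uniq (A ++ C). Proof. by apply: uniq_part => a; rewrite !count_cat; lia. Qed.
Lemma uniq_B : uniq B. Proof. by apply: uniq_part => a; rewrite !count_cat; lia. Qed.
Lemma uniq_O : uniq O. Proof. by apply: uniq_part => a; rewrite !count_cat; lia. Qed.
Lemma uniq_A : uniq A. Proof. by apply: uniq_part => a; rewrite !count_cat; lia. Qed.

Lemma sizes_eq : size B = size A /\ size C = size A.
Proof. by split; [exact: ok_sizeB | exact: ok_sizeC]. Qed.

Hypothesis K2 : (2 < K)%N.
Hypothesis mm_regs : {in wregs mm, forall r, (r < K)%N}.
Hypothesis mm_arrs : {in warrs mm, forall a, (a < K)%N}.

Lemma warrs_block : {in warrs block, forall a, (a < K)%N}.
Proof.
move=> a; rewrite /block 5!warrs_seq !warrs_setloop warrs_sumloop warrs_mulp !warrs_lookup.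
rewrite warrs_powp !mem_cat => /or4P[].
- by rewrite mem_rcons inE orbF => /eqP ->; exact: leq_trans K2.
- by rewrite mem_rcons inE orbF => /eqP ->; exact: leq_trans K2.
- by [].
- by rewrite /= orbF; exact: mm_arrs.
Qed.

Lemma rAcc_block : rAcc K \notin wregs block.
Proof.
have ne1 : rAcc K != rI K by rewrite /rAcc /rI; lia.
have ne2 : rAcc K != 1%N by rewrite /rAcc; lia.
have ne3 : rAcc K != rIn K by rewrite /rAcc /rIn; lia.
have ne4 : rAcc K != rV K by rewrite /rAcc /rV; lia.
have ne5 : rAcc K != rV2 K by rewrite /rAcc /rV2; lia.
have look a r L : rAcc K != r -> (rAcc K \in wregs (@lookup K k a r L)) = false.
  by move=> ne; apply/negP => /wregs_lookup /eqP; exact/negP.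
rewrite /block 5!wregs_seq 5!mem_cat !wregs_setloop // wregs_sumloop // wregs_mulp !look //.
rewrite (negPf ne3) (negPf ne4) /= inE (negPf ne2) /= orbF.
apply/negP => /orP[/wregs_powp|/mm_regs]; rewrite /rAcc; lia.
Qed.

(** * Sizes of the intermediate values *)

Hypothesis n0 : (0 < n)%N.

Lemma pow_uniq (L : seq 'I_k) : uniq L -> (n ^ size L <= n ^ k)%N.
Proof. by move=> uL; apply: leq_pexp2l => //; exact: size_uniq_ord. Qed.

Lemma norm_table_value L cs : uniq L -> forall e : env, (`|sumL L (edge_prod H cs) e| <= n ^ k)%N.
Proof.
move=> uL e; apply: leq_trans (norm_sumL _ _ (B := 1) _) _ => [f|].
  exact: norm_edge_prod.
by rewrite muln1; exact: pow_uniq.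
Qed.

(** Each table entry is at most n^k, and so is the number of terms of each sum. Multiplying these
    bounds gives the exponents 3k here, then 4k, 5k and finally 6k for the sum over [O]. *)
Lemma norm_value13 (e : env) : (`|value13 e| <= n ^ (3 * k))%N.
Proof.
apply: leq_trans (norm_sumL _ _ (B := n ^ k * n ^ k) _) _ => [f|].
  by rewrite abszM leq_mul // norm_table_value // ?uniq_priv1 ?uniq_priv3.
rewrite -expnD (_ : 3 * k = k + (k + k))%N; last by lia.
by rewrite [X in (_ <= X)%N]expnD leq_mul // pow_uniq // uniq_B.
Qed.

Lemma norm_value132 (e : env) : (`|(value13 e * value2 e)%R| <= n ^ (4 * k))%N.
Proof.
rewrite abszM (_ : 4 * k = 3 * k + k)%N; last by lia.
by rewrite expnD leq_mul // ?norm_value13 // norm_table_value // uniq_priv2.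
Qed.

Lemma norm_block_value (e : env) : (`|block_value e| <= n ^ (5 * k))%N.
Proof.
apply: leq_trans (norm_sumL _ _ norm_value132) _.
rewrite (_ : 5 * k = k + 4 * k)%N; last by lia.
by rewrite expnD leq_mul // pow_uniq // uniq_AC.
Qed.

Lemma tables_inv As : {in As, forall a, (a < K)%N} -> arr_inv tables_in As.
Proof.
move=> HA s s' eqA [G T1 T2 T3].
have e j i : (K <= j)%N -> arr s' j i = arr s j i.
  by move=> Kj; apply: eqA; apply/negP => /HA; rewrite ltnNge Kj.
split=> [i j|g|g|g]; rewrite e ?leq_addr //; exact: G.
Qed.

Hypothesis W1 : (n.+2 ^ (6 * k + 2) <= W)%N.

Lemma pow_uniq_W (L : seq 'I_k) : uniq L -> (n ^ size L <= W)%N.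
Proof. by move=> uL; apply: leq_trans (pow_uniq uL) _; apply: (pow_le_W n0 W1); lia. Qed.

Lemma table_prog_does I a L Lp cs : uniq L -> uniq Lp -> {in L, forall v, v \notin Lp} ->
  within (L ++ Lp) cs -> arr_inv I [:: a] -> (forall s, I s -> graph_in s) ->
  does I (fun=> True) (table_prog a L Lp cs) (L ++ Lp)
    (fun _ s' => forall g, arr s' a (idx L g) = sumL Lp (edge_prod H cs) g)
    (table_time (size L) (size Lp) (size cs)).
Proof.
move=> uL uLp LLp wcs HI IG.
have HI0 : arr_inv I [::] by apply: arr_inv_sub HI.
have Ee : computes I (fun=> True) (edgep K (rV K) (rT K) cs) (rV K) [::] (edge_prod H cs)
    (2 + 4 * size cs).
  apply: edgep_computes => //; first by rewrite /rV /rT; lia.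
  - by rewrite -[(n * n)%N]/(n ^ 2)%N; apply: (pow_le_W n0 W1); lia.
  - by rewrite -(expn0 n); apply: (pow_le_W n0 W1).
have Es : computes I (fun=> True) (sumloop K (rIn K) (rV K) Lp (edgep K (rV K) (rT K) cs))
    (rIn K) (Lp ++ [::]) (sumL Lp (edge_prod H cs)) (1 + ltime (size Lp) (2 + 4 * size cs + 1)).
  apply: (sumloop_computes Ee (B := 1%N)) => //.
  - by rewrite warrs_edgep.
  - by apply/negP => /wregs_edgep []; rewrite /rIn /rV /rT; lia.
  - by move=> e f /agreeP ef; have -> // : f = e by apply/ffunP => v; exact: ef.
  - exact: norm_edge_prod.
  - by rewrite muln1; apply: leq_trans (pow_uniq uLp) _; apply: (pow_le_W n0 W1); lia.
rewrite cats0 in Es.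
have iF : indep Lp (sumL Lp (edge_prod H cs)) by exact: indep_sumL_self.
have := setloop_does (a := a) (ri := rI K) Es; rewrite warrs_sumloop warrs_edgep.
move=> /(_ L HI isT (scratch_rIn K) (scratch_rI K)) H1 s e fs es _ Is.
have rr : rI K != rIn K by rewrite /rI /rIn; lia.
have nW : (n ^ size L <= W)%N by apply: leq_trans (pow_uniq uL) _; apply: (pow_le_W n0 W1); lia.
have := H1 rr iF nW uL LLp (fun _ _ _ _ => Logic.I) s e fs es Logic.I Is.
apply: (runs_mono (leqnn _)) => s' [e' [es' ee' E]]; exists e'; split=> // g.
apply: (table_extend_all (e := e)) => //.
(* A vertex outside [L] is either summed over or occurs in no edge of [cs], so the entries are valid
   for every [g]. *)
apply: (@indep_sub _ _ _ (Lp ++ [seq v <- enum 'I_k | v \notin L ++ Lp])).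
  move=> v; rewrite mem_filter mem_cat mem_filter mem_cat mem_enum => /andP[/negPf -> _].
  by case: (v \in Lp).
apply: indep_cat => //; apply: indep_sumL; apply: edge_prod_indep => c /(allP wcs) /andP[c1 c2].
by rewrite !mem_filter c1 c2.
Qed.

Hypothesis mm_spec : forall N, (0 < N)%N -> ram_mulmx mm d N N (fun t => (t <= tm N)%N).
Hypothesis W2 : (n.+2 ^ ((k + 3) * d) <= W)%N.

(** The sum is at most 3(n+2)^k + 2 <= 8(n+2)^k <= (n+2)^(k+3). *)
Lemma word_bound_mm : ((n ^ size A + n ^ size A + n ^ k + 2) ^ d <= W)%N.
Proof.
apply: leq_trans W2; rewrite expnM; case: (d) => // d'; rewrite leq_exp2r //.
have le1 := pow_uniq uniq_A.
have le2 : (n ^ k <= n.+2 ^ k)%N by case: (k) => // k'; rewrite leq_exp2r //; lia.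
have le3 : (1 <= n.+2 ^ k)%N by rewrite expn_gt0.
have le4 : (2 ^ 3 <= n.+2 ^ 3)%N by rewrite leq_exp2r.
rewrite expnD; apply: (@leq_trans (n.+2 ^ k * 2 ^ 3)%N); last by rewrite leq_mul2l le4 orbT.
rewrite (_ : 2 ^ 3 = 8)%N //; move: le1 le2 le3; clear.
move: (n ^ size A)%N (n ^ k)%N (n.+2 ^ k)%N => a b c; lia.
Qed.

Lemma mm_step s : fits W s -> reg s 0 = (n ^ size A)%N -> reg s 1 = (n ^ size A)%N ->
  (forall i, (i < n ^ size (A ++ B))%N -> (`|arr s 0 i| <= n ^ k)%N) ->
  (forall i, (i < n ^ size (B ++ C))%N -> (`|arr s 1 i| <= n ^ k)%N) ->
  runs W mm s (tm (n ^ size A)) (fun s' => forall i j,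
    (i < n ^ size A)%N -> (j < n ^ size A)%N ->
    arr s' 2 (i * n ^ size A + j)%N =
    \sum_(l < n ^ size A) arr s 0 (i * n ^ size A + l)%N * arr s 1 (l * n ^ size A + j)%N).
Proof.
have [sB sC] := sizes_eq.
set N := (n ^ size A)%N => fs s0 s1 b0 b1.
have N0 : (0 < N)%N by rewrite expn_gt0 n0.
have lt2 i j : (i < N)%N -> (j < N)%N -> (i * N + j < n ^ (size A + size A))%N.
  by move=> iN jN; rewrite expnD -/N; nia.
pose MA : 'M[int]_(N, N) := \matrix_(i, j) arr s 0 (i * N + j)%N.
pose MB : 'M[int]_(N, N) := \matrix_(i, j) arr s 1 (i * N + j)%N.
have bA i j : (`|MA i j| <= n ^ k)%N.
  by rewrite mxE; apply: b0; rewrite size_cat sB lt2.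
have bB i j : (`|MB i j| <= n ^ k)%N.
  by rewrite mxE; apply: b1; rewrite size_cat sB sC lt2.
have [|t [s' [ex st le]]] := mm_spec N0 bA bB word_bound_mm fs.
  by split=> // i j; rewrite mxE.
exists t, s'; split=> // i j iN jN.
rewrite (st (Ordinal iN) (Ordinal jN)) mxE.
by apply: eq_bigr => l _; rewrite !mxE.
Qed.

Lemma block_computes :
  computes tables_in (fun=> True) block (rIn K) (A ++ B ++ C) block_value block_time.
Proof.
have [sB sC] := sizes_eq.
have Tinv := tables_inv.
have inv0 : arr_inv tables_in [::] by exact: Tinv.
move=> s e fs es _ Is.
have l1 : computes tables_in (fun=> True) (lookup K (K + 1) (rV K) (pl_table1 x)) (rV K)
    [::] value1 (3 + 2 * size (pl_table1 x)).
  apply: lookup_computes => //; first exact/pow_uniq_W/(ok_uniq1 x_ok).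
  by move=> s1 e1 _ [_ T1 _ _].
have l3 : computes tables_in (fun=> True) (lookup K (K + 3) (rV K) (pl_table3 x)) (rV K)
    [::] value3 (3 + 2 * size (pl_table3 x)).
  apply: lookup_computes => //; first exact/pow_uniq_W/(ok_uniq3 x_ok).
  by move=> s1 e1 _ [_ _ _ T3].
have rIV : rI K != rV K by rewrite /rI /rV; lia.
have indep_nil (F : env -> int) : indep [::] F.
  by move=> f g /agreeP fg; have -> // : g = f by apply/ffunP => v; exact: fg.
have does_AB : does tables_in (fun=> True)
    (setloop K 0 (rV K) (rI K) (A ++ B) (lookup K (K + 1) (rV K) (pl_table1 x)))
    ((A ++ B) ++ [::]) (fun e s' => forall f, agree (A ++ B) e f ->
       arr s' 0 (idx (A ++ B) f) = value1 f)
    (ltime (size (A ++ B)) (3 + 2 * size (pl_table1 x) + (3 + 2 * size (A ++ B)))).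
  apply: setloop_does => //; rewrite ?warrs_lookup //.
  - by apply: Tinv => a; rewrite inE => /eqP ->; lia.
  - exact/pow_uniq_W/uniq_AB.
  - exact: uniq_AB.
have does_BC : does tables_in (fun=> True)
    (setloop K 1 (rV K) (rI K) (B ++ C) (lookup K (K + 3) (rV K) (pl_table3 x)))
    ((B ++ C) ++ [::]) (fun e s' => forall f, agree (B ++ C) e f ->
       arr s' 1 (idx (B ++ C) f) = value3 f)
    (ltime (size (B ++ C)) (3 + 2 * size (pl_table3 x) + (3 + 2 * size (B ++ C)))).
  apply: setloop_does => //; rewrite ?warrs_lookup //.
  - by apply: Tinv => a; rewrite inE => /eqP ->; lia.
  - exact/pow_uniq_W/uniq_BC.
  - exact: uniq_BC.
rewrite !cats0 in does_AB does_BC.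
apply: runs_seq; have := runs_frame fs (does_AB s e fs es Logic.I Is).
apply: (runs_mono (leqnn _)) => s1 [[e1 [es1 ee1 tab0]] fs1 _ fa1].
rewrite warrs_setloop warrs_lookup /= in fa1.
have inv_0 : arr_inv tables_in [:: 0%N] by apply: Tinv => a; rewrite inE => /eqP ->; lia.
have inv_1 : arr_inv tables_in [:: 1%N] by apply: Tinv => a; rewrite inE => /eqP ->; lia.
have Is1 : tables_in s1 := inv_0 _ _ fa1 Is.
apply: runs_seq; have := runs_frame fs1 (does_BC s1 e1 fs1 es1 Logic.I Is1).
apply: (runs_mono (leqnn _)) => s2 [[e2 [es2 ee2 tab1]] fs2 _ fa2].
rewrite warrs_setloop warrs_lookup /= in fa2.
have Is2 : tables_in s2 := inv_1 _ _ fa2 Is1.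
have arr0 i : arr s2 0 i = arr s1 0 i by rewrite fa2.
have ABC_e1 : agree (A ++ B ++ C) e e1.
  by apply: agree_sub ee1 => v; rewrite !mem_cat orbA => ->.
have ABC_e2 : agree (A ++ B ++ C) e e2.
  apply: agree_trans ABC_e1 _; apply: agree_sub ee2 => v vBC.
  by rewrite mem_cat vBC orbT.
(* The first operand was filled before the loop for the second one moved [C]; table 1 ignores
   [C]. *)
have val0 g : agree (A ++ B ++ C) e g -> arr s2 0 (idx (A ++ B) g) = value1 g.
  move=> eg; rewrite arr0; apply: (table_extend tab0 (X := C)).
  - by apply: value1_indep => v ->.
  - by rewrite -catA.
  - move=> v; rewrite mem_cat => vAB; apply/negP => vC.
    by have := plan_disjoint v; move: vAB vC; do ![case: (v \in _) => //=].
have val1 g : agree (A ++ B ++ C) e g -> arr s2 1 (idx (B ++ C) g) = value3 g.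
  move=> eg; apply: (table_extend tab1 (X := A)).
  - by apply: value3_indep => v ->.
  - apply: (@agree_trans _ _ _ _ e).
      rewrite agree_sym; apply: agree_sub ee1 => v; rewrite !mem_cat.
      by case/orP => ->; rewrite ?orbT.
    by apply: agree_sub eg => v; rewrite !mem_cat => /or3P[] ->; rewrite ?orbT.
  - move=> v; rewrite mem_cat => vAB; apply/negP => vC.
    by have := plan_disjoint v; move: vAB vC; do ![case: (v \in _) => //=].
have N_W : (n ^ size A <= W)%N by rewrite -sB; apply: pow_uniq_W uniq_B.
have W_1 : (1 <= W)%N by rewrite -(expn0 n); apply: (pow_le_W n0 W1).
apply: runs_seq; have := runs_frame fs2 (powp_runs K2 W_1 N_W n0 fs2 es2).
apply: (runs_mono (leqnn _)) => s3 [[es3 r0] fs3 _ fa3].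
rewrite warrs_powp in fa3.
have s1s : scratch K 1 by rewrite /scratch (leq_trans _ K2).
have V : eval_op OMul (reg s3 0) (reg s3 (rOne K)) = (n ^ size A)%N.
  by case: es3 => _ E _; rewrite /= E r0 mulr1.
apply: runs_seq; apply: runs_op; rewrite V //.
set s4 := set_reg s3 _ _.
have fs4 : fits W s4 by case: fs3 => f1 f2; split=> // r /=; case: eqP.
have es4 : env_in s4 e2 by exact: env_in_set.
have arr4 a i : arr s4 a i = arr s2 a i by rewrite /s4 /= fa3.
have Is4 : tables_in s4 by apply: inv0 Is2 => a i _; rewrite arr4.
apply: runs_seq.
have mmr : runs W mm s4 (tm (n ^ size A)) _ := @mm_step s4 fs4 _ _ _ _.
have {mmr} := runs_frame fs4 (mmr _ _ _ _).
have bnd0 i : (i < n ^ size (A ++ B))%N -> (`|arr s4 0 i| <= n ^ k)%N.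
  move=> iAB; have [f ef <-] := idx_onto e uniq_AB iAB.
  rewrite arr4 val0; first exact/norm_table_value/uniq_priv1.
  by apply: agree_sub ef => v; rewrite !mem_cat orbA => ->.
have bnd1 i : (i < n ^ size (B ++ C))%N -> (`|arr s4 1 i| <= n ^ k)%N.
  move=> iAB; have [f ef <-] := idx_onto e uniq_BC iAB.
  rewrite arr4 val1; first exact/norm_table_value/uniq_priv3.
  by apply: agree_sub ef => v vBC; rewrite mem_cat vBC orbT.
move=> /(_ r0 erefl bnd0 bnd1).
apply: (runs_mono (leqnn _)) => s5 [prod5 fs5 fr5 fa5].
have es5 : env_in s5 e2.
  by apply: env_in_frame es4 _ fr5 => r /mm_regs rK; rewrite inE rK.
have Is5 : tables_in s5 := Tinv _ mm_arrs _ _ fa5 Is4.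
pose D5 (f : env) := agree (A ++ B ++ C) e f.
(* From here on array 2 belongs to the invariant. The product is correct only for the current images
   of [O], whence the restriction to [D5]. *)
pose I5 (s' : state) := tables_in s' /\
  forall f, D5 f -> arr s' 2 (idx (A ++ C) f) = value13 f.
have I5s : I5 s5.
  split=> // f ef; rewrite idx_cat sC prod5 ?idx_lt //; last by rewrite -sC idx_lt.
  (* An index over [A ++ C] is a row number and a column number; the middle index of the product is
     then turned back into an assignment of [B]. *)
  transitivity (sumL B (fun g => arr s4 0 (idx A f * n ^ size A + idx B g)%N *
       arr s4 1 (idx B g * n ^ size A + idx C f)%N) f).
    rewrite (sumL_idx (fun l => arr s4 0 (idx A f * n ^ size A + l)%N *
       arr s4 1 (l * n ^ size A + idx C f)%N)) ?sB //; exact: uniq_B.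
  apply: eq_sumL => g fg.
  have eg : agree (A ++ B ++ C) e g.
    apply: agree_trans ef _; apply: agree_sub fg => v vB.
    by rewrite !mem_cat vB orbT.
  have ixA : idx A f = idx A g.
    apply: eq_idx => v vA; apply/esym; move/agreeP: fg; apply.
    by apply/negP => vB; have := plan_disjoint v; move: vA vB; do ![case: (v \in _) => //=].
  have ixC : idx C f = idx C g.
    apply: eq_idx => v vA; apply/esym; move/agreeP: fg; apply.
    by apply/negP => vB; have := plan_disjoint v; move: vA vB; do ![case: (v \in _) => //=].
  by rewrite ixA ixC -(val0 g eg) -(val1 g eg) !idx_cat sB sC !arr4.
have I5inv : arr_inv I5 [::].
  move=> s' s'' eqA [I1 I2]; split; first exact: inv0 I1.
  by move=> g Dg; rewrite eqA ?I2.
have l2 : computes I5 D5 (lookup K 2 (rV K) (A ++ C)) (rV K) [::] value13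
    (3 + 2 * size (A ++ C)).
  apply: lookup_computes => //; first exact/pow_uniq_W/uniq_AC.
  by move=> s0 g Dg [_ ->].
have l4 : computes I5 D5 (lookup K (K + 2) (rV2 K) (pl_table2 x)) (rV2 K) [::] value2
    (3 + 2 * size (pl_table2 x)).
  apply: lookup_computes => //; first exact/pow_uniq_W/(ok_uniq2 x_ok).
  by move=> s0 g Dg [[_ _ -> _] _].
have lm := mulp_computes (scratch_rV K) l2 l4.
rewrite warrs_lookup in lm.
have lm1 : rV K \notin wregs (lookup K (K + 2) (rV2 K) (pl_table2 x)).
  by apply/negP => /wregs_lookup; rewrite /rV /rV2; lia.
have lm2 f : (`|(value13 f * value2 f)%R| <= W)%N.
  by apply: leq_trans (norm_value132 f) _; apply: (pow_le_W n0 W1); lia.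
have {}lm := lm I5inv lm1 lm2.
have De2 : D5 e2 by [].
have HD : closed_under ((A ++ C) ++ [::]) D5.
  move=> f g fg Df; apply: agree_trans Df _; apply: agree_sub fg => v.
  by rewrite cats0 !mem_cat => /orP[] ->; rewrite ?orbT.
have lsum := sumloop_computes lm _ _ (scratch_rIn K) (indep_nil _) norm_value132 _ uniq_AC
  (fun _ _ => isT) HD.
rewrite warrs_mulp !warrs_lookup in lsum.
have nacc : rIn K \notin wregs (mulp (rV K) (rV2 K) (lookup K 2 (rV K) (A ++ C))
     (lookup K (K + 2) (rV2 K) (pl_table2 x))).
  rewrite wregs_mulp; apply/negP => /or3P[/wregs_lookup|/wregs_lookup|/eqP];
  by rewrite /rIn /rV /rV2; lia.
have bW : (n ^ size (A ++ C) * n ^ (4 * k) <= W)%N.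
  apply: (@leq_trans (n ^ k * n ^ (4 * k))%N); first by rewrite leq_mul // pow_uniq // uniq_AC.
  by rewrite -expnD; apply: (pow_le_W n0 W1); lia.
have := lsum I5inv nacc bW s5 e2 fs5 es5 De2 I5s.
apply: (runs_mono (leqnn _)) => s6 [e6 [es6 ee6 r6]]; exists e6; split=> //.
  apply: agree_trans ABC_e2 _; apply: agree_sub ee6 => v.
  by rewrite cats0 !mem_cat => /orP[] ->; rewrite ?orbT.
by rewrite r6 -(block_value_indep ABC_e2).
Qed.

Variable val : int.
Hypothesis x_value : forall e : env, plan_value x H e = val.

Lemma plan_prog_computes :
  computes graph_in (fun=> True) plan_prog (rAcc K) (enum 'I_k)
    (fun=> val) plan_time.
Proof.
move=> s e fs es _ Is.
have all_agree (f g : env) : agree (enum 'I_k) f g.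
  by apply/agreeP => v; rewrite mem_enum.
have warrs_table a L Lp cs : warrs (table_prog a L Lp cs) = [:: a].
  by rewrite /table_prog warrs_setloop warrs_sumloop warrs_edgep.
(* The invariant grows by one table at a time, and each is stable under writes to the arrays of the
   later tables. *)
pose I1 s := graph_in s /\ forall g : env, arr s (K + 1)%N (idx (pl_table1 x) g) = value1 g.
pose I2 s := I1 s /\ forall g : env, arr s (K + 2)%N (idx (pl_table2 x) g) = value2 g.
have inv0 a : (K < a)%N -> arr_inv graph_in [:: a].
  by move=> Ka s1 s2 eqA G i j; rewrite eqA // inE; lia.
have inv1 a : (K + 1 < a)%N -> arr_inv I1 [:: a].
  move=> Ka s1 s2 eqA [G T]; split; first by apply: (inv0 a) eqA G; lia.
  by move=> g; rewrite eqA // inE; lia.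
have inv2 a : (K + 2 < a)%N -> arr_inv I2 [:: a].
  move=> Ka s1 s2 eqA [G T]; split; first by apply: (inv1 a) eqA G; lia.
  by move=> g; rewrite eqA // inE; lia.
have disj1 : {in pl_table1 x, forall v, v \notin pl_priv1 x}.
  move=> v /mem_table1 vt; apply/negP => vp; have := plan_disjoint v.
  by move: vt vp; do ![case: (v \in _) => //=].
have disj2 : {in pl_table2 x, forall v, v \notin pl_priv2 x}.
  move=> v /mem_table2 vt; apply/negP => vp; have := plan_disjoint v.
  by move: vt vp; do ![case: (v \in _) => //=].
have disj3 : {in pl_table3 x, forall v, v \notin pl_priv3 x}.
  move=> v /mem_table3 vt; apply/negP => vp; have := plan_disjoint v.
  by move: vt vp; do ![case: (v \in _) => //=].
have d1 := table_prog_does (a := (K + 1)%N) (ok_uniq1 x_ok) uniq_priv1 disj1 (ok_edges1 x_ok)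
  (inv0 _ _) (fun _ => id).
have d2 := table_prog_does (a := (K + 2)%N) (I := I1) (ok_uniq2 x_ok) uniq_priv2 disj2
  (ok_edges2 x_ok) (inv1 _ _) (fun _ => @proj1 _ _).
have d3 := table_prog_does (a := (K + 3)%N) (I := I2) (ok_uniq3 x_ok) uniq_priv3 disj3
  (ok_edges3 x_ok) (inv2 _ _) (fun _ H => proj1 (proj1 H)).
apply: runs_seq; have := runs_frame fs (d1 _ s e fs es Logic.I Is).
move=> /(_ ltac:(lia)); apply: (runs_mono (leqnn _)) => s1 [[e1 [es1 _ T1]] fs1 _ fa1].
rewrite warrs_table in fa1.
have Is1 : I1 s1 by split=> //; apply: (inv0 (K + 1)%N) fa1 Is; lia.
apply: runs_seq; have := runs_frame fs1 (d2 _ s1 e1 fs1 es1 Logic.I Is1).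
move=> /(_ ltac:(lia)); apply: (runs_mono (leqnn _)) => s2 [[e2 [es2 _ T2]] fs2 _ fa2].
rewrite warrs_table in fa2.
have Is2 : I2 s2 by split=> //; apply: (inv1 (K + 2)%N) fa2 Is1; lia.
apply: runs_seq; have := runs_frame fs2 (d3 _ s2 e2 fs2 es2 Logic.I Is2).
move=> /(_ ltac:(lia)); apply: (runs_mono (leqnn _)) => s3 [[e3 [es3 _ T3]] fs3 _ fa3].
rewrite warrs_table in fa3.
have [[G3 T13] T23] : I2 s3 by apply: (inv2 (K + 3)%N) fa3 Is2; lia.
have Is3 : tables_in s3 by [].
have binv : arr_inv tables_in (warrs block) := tables_inv warrs_block.
have bW : (n ^ size O * n ^ (5 * k) <= W)%N.
  apply: (@leq_trans (n ^ k * n ^ (5 * k))%N); first by rewrite leq_mul // pow_uniq // uniq_O.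
  by rewrite -expnD; apply: (pow_le_W n0 W1); lia.
have OABC : {in O, forall v, v \notin A ++ B ++ C}.
  move=> v vO; rewrite !mem_cat; have := plan_disjoint v.
  by move: vO; do ![case: (v \in _) => //=].
have := sumloop_computes block_computes binv rAcc_block (scratch_rAcc K) block_value_indep
  norm_block_value bW uniq_O OABC (fun _ _ _ _ => Logic.I) fs3 es3 Logic.I Is3.
apply: (runs_mono (leqnn _)) => s4 [e4 [es4 _ r4]]; exists e4; split=> //.
(* The accumulator holds the nested sums; distributivity identifies them with [plan_value]. *)
rewrite r4 /block_value -sumL_cat sumL_factor; first exact: x_value.
- apply: edge_prod_indep_within (ok_edges1 x_ok) _ => v; rewrite !mem_cat => vL.
  have := plan_disjoint v; move: vL.
  by case/orP => [/mem_table1|]; do ![case: (v \in _) => //=].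
- apply: edge_prod_indep_within (ok_edges3 x_ok) _ => v; rewrite !mem_cat => vL.
  have := plan_disjoint v; move: vL.
  by case/orP => [/mem_table3|]; do ![case: (v \in _) => //=].
- apply: edge_prod_indep_within (ok_edges2 x_ok) _ => v; rewrite !mem_cat => vL.
  have := plan_disjoint v; move: vL.
  by case/orP => [/mem_table2|]; do ![case: (v \in _) => //=].
Qed.

End PlanProgram.

(** * The counting program *)

(** The empty host is treated apart, as an environment needs a host vertex. Only the pattern without
    vertices has a copy in it, and exactly one. *)
Lemma count_subgraphs_empty (k n : nat) (P : sgraph 'I_k) (H : sgraph 'I_n) :
  n = 0%N -> count_subgraphs P H = (k == 0%N).
Proof.
move=> n0; have := card_embeddings P H; have := automorphisms_gt0 P.
case: (posnP k) => [k0|k_gt0].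
  have -> : embeddings P H = [set: _].
    apply/setP => f; rewrite !inE; apply/andP; split.
      by apply/injectiveP => u; exfalso; have := ltn_ord u; lia.
    by apply/forallP => u; exfalso; have := ltn_ord u; lia.
  have -> : #|[set: {ffun 'I_k -> 'I_n}]| = 1%N.
    by rewrite cardsT card_ffun !card_ord k0.
  move=> _ /esym /eqP.
  by rewrite muln_eq1 => /andP[/eqP ->].
have -> : embeddings P H = finset.set0.
  by apply/setP => f; exfalso; move: (ltn_ord (f (Ordinal k_gt0))); lia.
by rewrite cards0 => aut0 /esym /eqP; rewrite muln_eq0 eqn0Ngt => /orP[]; lia.
Qed.

Section MainProgram.

Variables (K k : nat) (mm : cmd) (d : nat) (tm : nat -> nat).

Fixpoint init_vars (L : seq 'I_k) : cmd :=
  if L is v :: L' then Seq (Const (var K v) 0) (init_vars L') else Skip.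

Lemma init_vars_runs W L s : fits W s -> runs W (init_vars L) s (size L + 1) (fun s' =>
  [/\ fits W s', {in L, forall v, reg s' (var K v) = 0},
      forall r, {in L, forall v, r != var K v} -> reg s' r = reg s r &
      forall a i, arr s' a i = arr s a i]).
Proof.
elim: L s => [|v L IH] s fs /=; first by exists 1%N, s; split=> //; constructor.
apply: (@runs_mono _ _ _ (1 + (size L + 1)) _ (fun s' =>
  [/\ fits W s', {in v :: L, forall v, reg s' (var K v) = 0},
      forall r, {in v :: L, forall v, r != var K v} -> reg s' r = reg s r &
      forall a i, arr s' a i = arr s a i])) => //.
apply: runs_seq; apply: runs_const => //.
have fs1 : fits W (set_reg s (var K v) 0).
  by case: fs => f1 f2; split=> // r /=; case: eqP.
apply: (runs_mono (leqnn _)) (IH _ fs1) => s' [fs' L0 fr fa]; split=> //.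
- move=> u; rewrite inE; have [uL _|uL] := boolP (u \in L); first exact: L0.
  rewrite orbF => /eqP Euv; rewrite fr /= ?Euv ?eqxx // => w wL.
  apply/eqP => E; move: uL; rewrite Euv (_ : v = w) ?wL //.
  by apply: val_inj => /=; move: E; rewrite /var; lia.
- move=> r rL; rewrite fr /=; last by move=> w wL; apply: rL; rewrite inE wL orbT.
  by rewrite (negPf (rL v (mem_head _ _))).
Qed.

Hypothesis K2 : (2 < K)%N.
Hypothesis mm_regs : {in wregs mm, forall r, (r < K)%N}.
Hypothesis mm_arrs : {in warrs mm, forall a, (a < K)%N}.
Hypothesis mm_spec : forall N, (0 < N)%N -> ram_mulmx mm d N N (fun t => (t <= tm N)%N).

Definition rRes : nat := (K + 2)%N.

Lemma warrs_plan_prog (x : plan 'I_k) a : a \in warrs (plan_prog K mm x) -> a != K.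
Proof.
have wt b L Lp cs : warrs (@table_prog K k b L Lp cs) = [:: b].
  by rewrite /table_prog warrs_setloop warrs_sumloop warrs_edgep.
rewrite /plan_prog 3!warrs_seq 3!mem_cat !wt warrs_sumloop !inE => /or4P[].
- by move/eqP ->; lia.
- by move/eqP ->; lia.
- by move/eqP ->; lia.
by move/(warrs_block K2 mm_arrs); lia.
Qed.

Lemma rRes_plan_prog (x : plan 'I_k) : rRes \notin wregs (@plan_prog K k mm x).
Proof.
have sR : scratch K rRes by rewrite /scratch /temp /rRes; lia.
have ne1 : rRes != rI K by rewrite /rRes /rI; lia.
have ne2 : rRes != 1%N by rewrite /rRes; lia.
have ne3 : rRes != rIn K by rewrite /rRes /rIn; lia.
have ne4 : rRes != rV K by rewrite /rRes /rV; lia.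
have ne5 : rRes != rV2 K by rewrite /rRes /rV2; lia.
have ne6 : rRes != rT K by rewrite /rRes /rT; lia.
have ne7 : rRes != rAcc K by rewrite /rRes /rAcc; lia.
have look a r L : rRes != r -> (rRes \in wregs (@lookup K k a r L)) = false.
  by move=> ne; apply/negP => /wregs_lookup /eqP; exact/negP.
have wt b L Lp cs : (rRes \in wregs (@table_prog K k b L Lp cs)) = false.
  rewrite /table_prog wregs_setloop // wregs_sumloop // (negPf ne3) /=.
  by apply/negP => /wregs_edgep [] /eqP; apply/negP.
have wb : (rRes \in wregs (@block K k mm x)) = false.
  rewrite /block 5!wregs_seq 5!mem_cat !wregs_setloop // wregs_sumloop // wregs_mulp !look //.
  rewrite (negPf ne3) (negPf ne4) /= inE (negPf ne2) /= orbF.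
  apply/negP => /orP[/wregs_powp|/mm_regs]; rewrite /rRes; lia.
by rewrite /plan_prog 3!wregs_seq 3!mem_cat !wt wregs_sumloop // wb (negPf ne7).
Qed.

Variable pl : {ffun 'I_k -> 'I_k} -> plan 'I_k.

Fixpoint sum_plans (qs : seq (int * {ffun 'I_k -> 'I_k})) : cmd :=
  if qs is x :: qs' then
    Seq (plan_prog K mm (pl x.2)) (Seq (Const (rV K) x.1)
      (Seq (Op OMul (rV K) (rV K) (rAcc K)) (Seq (Op OAdd rRes rRes (rV K)) (sum_plans qs'))))
  else Skip.

(** The input occupies array 0, which is about to receive matrix operands. *)
Definition copy_graph : cmd :=
  Seq (Op OMul (rV2 K) (rN K) (rN K))
    (for_ (rT K) (rV2 K) (rOne K) (Seq (ArrGet (rV K) 0 (rT K)) (ArrSet K (rT K) (rV K)))).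

(** The coefficients and [aut] depend on the pattern only and are literals of the program. The final
    division is exact by [card_embeddings]. *)
Definition count_prog (qs : seq (int * {ffun 'I_k -> 'I_k})) (aut : nat) : cmd :=
  Seq (Const (rOne K) 1) (Seq (Op OMul (rN K) 0 (rOne K))
    (IfPos (rN K)
      (Seq (init_vars (enum 'I_k)) (Seq copy_graph (Seq (Const rRes 0) (Seq (sum_plans qs)
        (Seq (Const (rV K) aut) (Op ODiv 0 rRes (rV K)))))))
      (Const 0 (k == 0%N : nat)))).

Fixpoint sum_time (n : nat) (qs : seq (int * {ffun 'I_k -> 'I_k})) : nat :=
  if qs is x :: qs' then (plan_time (pl x.2) n tm + (3 + sum_time n qs'))%N else 1%N.

Definition count_time (qs : seq (int * {ffun 'I_k -> 'I_k})) (n : nat) : nat :=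
  (2 + (1 + ((k + 1) + (1 + (2 + n * n * 4) + (1 + (sum_time n qs + 2))))))%N.

Section Run.

Variables (n W : nat) (H : rel 'I_n).

Local Notation env := {ffun 'I_k -> 'I_n}.

Hypothesis n0 : (0 < n)%N.
Hypothesis W1 : (n.+2 ^ (6 * k + 2) <= W)%N.
Lemma copy_graph_runs s (e : env) : fits W s -> env_in K s e ->
  (forall i j : 'I_n, arr s 0 (i * n + j)%N = (H i j : nat)) ->
  runs W copy_graph s (1 + (2 + n * n * 4)) (fun s' => [/\ fits W s', env_in K s' e
    & graph_in K H s']).
Proof.
move=> fs es gs.
have sV : scratch K (rV K) by exact: scratch_rV.
have sV2 : scratch K (rV2 K) by exact: scratch_rV2.
have sT : scratch K (rT K) by exact: scratch_rT.
have nnW : (n * n <= W)%N.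
  by rewrite -[(n * n)%N]/(n ^ 2)%N; apply: (pow_le_W n0 W1); lia.
have neTV : rT K != rV K by rewrite /rT /rV; lia.
have fs_set s1 y (z : int) : (`|z| <= W)%N -> fits W s1 -> fits W (set_reg s1 y z).
  by move=> zW' [f1 f2]; split=> // r' /=; case: eqP.
have V : eval_op OMul (reg s (rN K)) (reg s (rN K)) = (n * n)%N.
  by case: es => E _ _; rewrite /= E; lia.
apply: runs_seq; apply: runs_op; rewrite V //.
set s1 := set_reg s _ _.
have fs1 : fits W s1 by exact: fs_set.
pose J (m : nat) (s' : state) := [/\ env_in K s' e, forall i, arr s' 0 i = arr s 0 i
  & forall i, (m <= i < n * n)%N -> arr s' K i = arr s 0 i].
have K0 : (0 == K) = false by apply/eqP; lia.
have loop : runs W (for_ (rT K) (rV2 K) (rOne K)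
    (Seq (ArrGet (rV K) 0 (rT K)) (ArrSet K (rT K) (rV K)))) s1 (2 + n * n * (2 + 2))
    (fun s2 => J 0%N s2 /\ reg s2 (rT K) = 0).
  apply: runs_for => //.
  - by rewrite /rT /rOne; lia.
  - by rewrite /= eqxx.
  - split=> // [|i]; first exact: env_in_set.
    by case: ltnP => //; rewrite andbF.
  - by move=> i s2 [[]].
  - move=> i s2 y [E1 E2 E3]; split=> //; exact: env_in_set.
  move=> i s2 im fs2 [E1 E2 E3] Ti.
  apply: (@runs_mono _ _ _ (1 + 1) _ (fun s' => J i s' /\ reg s' (rT K) = i)) => //.
  apply: runs_seq; apply: (@runs_get _ _ _ _ _ _ _ fs2 Ti); rewrite E2.
  set s3 := set_reg s2 _ _.
  have fs3 : fits W s3.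
    by apply: fs_set => //; rewrite -E2; case: fs2.
  have Ti3 : reg s3 (rT K) = i by rewrite /= (negPf neTV).
  apply: (@runs_set _ _ _ _ _ _ _ fs3 Ti3); split=> //; split.
  - exact/env_in_set_arr/env_in_set.
  - by move=> j /=; rewrite K0 E2.
  - move=> j /andP[ij jn] /=; rewrite !eqxx /=; case: eqP => [->|/eqP ne] //.
    by apply: E3; rewrite jn andbT ltn_neqAle eq_sym ne.
have := runs_frame fs1 loop; apply: runs_mono => // s2 [[[E1 E2 E3] _] fs2 _ _].
split=> // i j; rewrite E3 //=.
by have := ltn_ord i; have := ltn_ord j; nia.
Qed.

Hypothesis W2 : (n.+2 ^ ((k + 3) * d) <= W)%N.

Lemma norm_plan_value (x : plan 'I_k) (e : env) : plan_ok x ->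
  (`|plan_value x H e| <= n ^ k)%N.
Proof.
move=> xok; apply: leq_trans (norm_sumL _ _ (B := 1%N) _) _ => [f|].
  by rewrite !edge_prodE -!natrM !mulnb; case: (_ && _).
rewrite muln1; apply: leq_pexp2l => //; exact: size_uniq_ord (ok_uniq xok).
Qed.

(** The terms have signs, so partial sums may exceed the final one; the bound with absolute values
    is preserved when a term moves into [a]. The values do not depend on the environment, which lets
    a fixed [e0] stand for the changing [e]. *)
Lemma sum_plans_runs (qs : seq (int * {ffun 'I_k -> 'I_k})) s (e : env) (a : int) (e0 : env) :
  (forall x, x \in qs -> plan_ok (pl x.2)) ->
  (forall x, x \in qs -> forall f g : env, plan_value (pl x.2) H f = plan_value (pl x.2) H g) ->
  (`|a| + (\sum_(x <- qs) `|x.1|) * n ^ k <= W)%N -> (\sum_(x <- qs) `|x.1| <= W)%N ->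
  fits W s -> env_in K s e -> graph_in K H s -> reg s rRes = a ->
  runs W (sum_plans qs) s (sum_time n qs) (fun s' =>
    reg s' rRes = a + \sum_(x <- qs) x.1 * plan_value (pl x.2) H e0).
Proof.
elim: qs s e a => [|x qs IH] s e a qs_ok qs_const;
  rewrite ?big_nil ?big_cons => aW zW fs es gs ra /=.
  by exists 1%N, s; split=> //; [constructor | rewrite addr0].
have xok := qs_ok x (mem_head _ _).
have xv := norm_plan_value e0 xok.
have zv : (`|(x.1 * plan_value (pl x.2) H e0)%R| <= `|x.1|%N * n ^ k)%N.
  by rewrite abszM leq_mul2l xv orbT.
have zle : (`|x.1|%N * n ^ k <= W)%N by apply: leq_trans aW; rewrite mulnDl; lia.
have sV : scratch K (rV K) by exact: scratch_rV.
have sR : scratch K rRes by rewrite /scratch /temp /rRes; lia.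
have neR : rRes != rV K by rewrite /rRes /rV; lia.
have neA : rAcc K != rV K by rewrite /rAcc /rV; lia.
have fs_set s1 y (z : int) : (`|z| <= W)%N -> fits W s1 -> fits W (set_reg s1 y z).
  by move=> zW' [f1 f2]; split=> // r' /=; case: eqP.
have := plan_prog_computes xok K2 mm_regs mm_arrs n0 W1 mm_spec W2
  (val := plan_value (pl x.2) H e0) (fun f => qs_const x (mem_head _ _) f e0).
move=> Hp; apply: runs_seq; have := runs_frame fs (Hp s e fs es Logic.I gs).
apply: (runs_mono (leqnn _)) => s1 [[e1 [es1 _ v1]] fs1 fr1 fa1].
have gs1 : graph_in K H s1.
  by move=> i j; rewrite fa1 ?gs //; apply/negP => /warrs_plan_prog; rewrite eqxx.
have r1 : reg s1 rRes = a by rewrite fr1 // rRes_plan_prog.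
apply: (@runs_mono _ _ _ (1 + (1 + (1 + sum_time n qs))) _ (fun s' => reg s' rRes =
   a + (x.1 * plan_value (pl x.2) H e0 + \sum_(x <- qs) x.1 * plan_value (pl x.2) H e0))) => //.
apply: runs_seq; apply: runs_const; first by lia.
set s2 := set_reg s1 _ _.
have fs2 : fits W s2 by apply: fs_set => //; lia.
have V2 : eval_op OMul (reg s2 (rV K)) (reg s2 (rAcc K)) = x.1 * plan_value (pl x.2) H e0.
  by rewrite /= eqxx (negPf neA) v1.
apply: runs_seq; apply: runs_op; rewrite V2; first exact: leq_trans zle.
set s3 := set_reg s2 _ _.
have fs3 : fits W s3 by apply: fs_set => //; exact: leq_trans zle.
have V3 : eval_op OAdd (reg s3 rRes) (reg s3 (rV K)) = a + x.1 * plan_value (pl x.2) H e0.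
  by rewrite /= eqxx !(negPf neR) r1.
have aW3 : (`|(a + x.1 * plan_value (pl x.2) H e0)%R| + (\sum_(j <- qs) `|j.1|) * n ^ k <= W)%N.
  apply: leq_trans aW; rewrite mulnDl addnA leq_add2r.
  by apply: leq_trans (leq_absD _ _) _; rewrite leq_add2l.
apply: runs_seq; apply: runs_op; rewrite V3; first by lia.
rewrite addrA; apply: (IH _ e1) => //.
- by move=> y yq; apply: qs_ok; rewrite inE yq orbT.
- by move=> y yq; apply: qs_const; rewrite inE yq orbT.
- by lia.
- by apply: fs_set => //; lia.
- by do 3!apply: env_in_set => //.
- by rewrite /= eqxx.
Qed.

End Run.

Lemma count_prog_correct (P : sgraph 'I_k) (qs : seq (int * {ffun 'I_k -> 'I_k})) :
  (forall x, x \in qs -> plan_ok (pl x.2)) ->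
  (forall n (H : sgraph 'I_n) x, x \in qs ->
     forall f g : {ffun 'I_k -> 'I_n}, plan_value (pl x.2) H f = plan_value (pl x.2) H g) ->
  (forall n (H : sgraph 'I_n) (e : {ffun 'I_k -> 'I_n}),
     \sum_(x <- qs) x.1 * plan_value (pl x.2) H e = #|embeddings P H|%:R) ->
  counts_in_time P (count_prog qs #|automorphisms P|) (count_time qs).
Proof.
move=> qs_ok qs_const qs_sum.
set aut := #|automorphisms P|.
have aut0 : (0 < aut)%N by exact: automorphisms_gt0.
pose Z := (\sum_(x <- qs) `|x.1|)%N.
(* The exponent adds up all demands: the intermediate values of a plan, the words of the
   multiplication program, the constant [aut], and [Z * n ^ k], which bounds the signed sum. *)
exists (6 * k + 2 + ((k + 3) * d + (aut + (Z + k))))%N => n H W s.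
set D := (6 * k + 2 + _)%N => DW fs [r0 gs].
have leD m : (m <= D)%N -> (n.+2 ^ m <= W)%N.
  by move=> mD; apply: leq_trans DW; rewrite addn2; exact: leq_pexp2l.
have W1 : (n.+2 ^ (6 * k + 2) <= W)%N by apply: leD; rewrite /D; lia.
have W2 : (n.+2 ^ ((k + 3) * d) <= W)%N by apply: leD; rewrite /D; lia.
have W_1 : (1 <= W)%N by rewrite -(expn0 n.+2); apply: leD.
have small m : (m <= D)%N -> (m <= W)%N.
  move=> mD; apply: leq_trans (leD m mD); apply: (@leq_trans (2 ^ m)%N).
    by apply/ltnW/ltn_expl.
  by case: (m) => // m'; rewrite leq_exp2r.
have autW : (aut <= W)%N by apply: small; rewrite /D; lia.
have ZW : (Z <= W)%N by apply: small; rewrite /D; lia.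
have ZnW : (Z * n ^ k <= W)%N.
  apply: leq_trans (leD (Z + k)%N _); last by rewrite /D; lia.
  rewrite expnD leq_mul //; last by case: (k) => // k'; rewrite leq_exp2r //; lia.
  apply: (@leq_trans (2 ^ Z)%N); first by apply/ltnW/ltn_expl.
  by case: (Z) => // m'; rewrite leq_exp2r.
have fs_set s1 y (z : int) : (`|z| <= W)%N -> fits W s1 -> fits W (set_reg s1 y z).
  by move=> zW' [f1 f2]; split=> // r' /=; case: eqP.
have KN : (rN K == rOne K) = false by apply/eqP; rewrite /rOne /rN; lia.
suff : runs W (count_prog qs aut) s (count_time qs n) (fun s' =>
    reg s' 0 = count_subgraphs P H).
  by move=> [t [s' [ex le E]]]; exists t, s'.
rewrite /count_time.
apply: (@runs_mono _ _ _ (1 + (1 + ((k + 1) + (1 + (2 + n * n * 4) +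
  (1 + (sum_time n qs + 2)))).+1)) _ (fun s' => reg s' 0 = count_subgraphs P H)) => //.
apply: runs_seq; apply: runs_const => //.
set s1 := set_reg s _ _.
have fs1 : fits W s1 by exact: fs_set.
have V1 : eval_op OMul (reg s1 0) (reg s1 (rOne K)) = n.
  by rewrite /= eqxx r0 mulr1.
have nW : (n <= W)%N by case: fs => /(_ 0%N); rewrite r0.
apply: runs_seq; apply: runs_op; rewrite V1 //.
set s2 := set_reg s1 _ _.
have fs2 : fits W s2 by exact: fs_set.
have rN2 : reg s2 (rN K) = n by rewrite /= eqxx.
have rOne2 : reg s2 (rOne K) = 1 by rewrite /= eq_sym KN eqxx.
have [n0|n_gt0] := posnP n.
  exists 2, (set_reg s2 0 (k == 0%N : nat)); split.
  - apply: exec_if_npos; first by rewrite rN2 n0.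
    by constructor; case: eqP.
  - by lia.
  - by rewrite (count_subgraphs_empty P H n0).
suff [t [s' [ex le E]]] : runs W (Seq (init_vars (enum 'I_k)) (Seq copy_graph
    (Seq (Const rRes 0) (Seq (sum_plans qs)
        (Seq (Const (rV K) aut) (Op ODiv 0 rRes (rV K)))))))
    s2 ((k + 1) + (1 + (2 + n * n * 4) + (1 + (sum_time n qs + 2))))
    (fun s' => reg s' 0 = count_subgraphs P H).
  by exists t.+1, s'; split=> //; apply: exec_if_pos ex; rewrite rN2 ltz_nat.
apply: runs_seq; have := @init_vars_runs W (enum 'I_k) _ fs2; rewrite size_enum_ord.
apply: (runs_mono (leqnn _)) => s3 [fs3 v3 fr3 fa3].
pose e : {ffun 'I_k -> 'I_n} := [ffun=> Ordinal n_gt0].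
have es3 : env_in K s3 e.
  split=> [| |v]; last by rewrite v3 ?ffunE // mem_enum.
  - by rewrite fr3 // => v _; rewrite /rN /var; lia.
  - by rewrite fr3 // => v _; rewrite /rOne /var; lia.
apply: runs_seq.
have gs3 (i j : 'I_n) : arr s3 0 (i * n + j)%N = (H i j : nat) by rewrite fa3; exact: gs.

apply: (runs_mono (leqnn _)) (copy_graph_runs n_gt0 W1 fs3 es3 gs3) => s4 [fs4 es4 gs4].
have sR : scratch K rRes by rewrite /scratch /temp /rRes; lia.
have sV : scratch K (rV K) by exact: scratch_rV.
have neR : rRes != rV K by rewrite /rRes /rV; lia.
apply: runs_seq; apply: runs_const => //.
set s5 := set_reg s4 _ _.
have fs5 : fits W s5 by exact: fs_set.
have es5 : env_in K s5 e by exact: env_in_set.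
have r5 : reg s5 rRes = 0 by rewrite /= eqxx.
apply: runs_seq; have := @sum_plans_runs n W H n_gt0 W1 W2 qs s5 e 0 e qs_ok
  (qs_const n H) _ ZW fs5 es5 gs4 r5.
rewrite add0r => /(_ ZnW); rewrite qs_sum.
move=> /(runs_frame fs5); apply: (runs_mono (leqnn _)) => s6 [r6 fs6 _ _].
(* No separate estimate is needed: the number of embeddings stands in a register of a state that
   fits. *)
have embW : (#|embeddings P H| <= W)%N by case: fs6 => /(_ rRes); rewrite r6 natz.
apply: (@runs_mono _ _ _ (1 + 1) _ (fun s' => reg s' 0 = count_subgraphs P H)) => //.
apply: runs_seq; apply: runs_const => //.
set s7 := set_reg s6 _ _.
have V7 : eval_op ODiv (reg s7 rRes) (reg s7 (rV K)) = count_subgraphs P H.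
  rewrite /= eqxx (negPf neR) r6 natz card_embeddings -/aut.
  by rewrite divz_nat mulnK.
apply: runs_op; rewrite V7 //.
apply: leq_trans embW; rewrite card_embeddings; exact: leq_pmulr.
Qed.

End MainProgram.

(** * Running time *)

From mathcomp Require Import boolp classical_sets reals topology sequences exp.

Local Open Scope classical_set_scope.

Section Growth.

Variable R : realType.

Implicit Types (T : nat -> nat) (E F : R).

(** One constant for all positive [n] composes well under sums, products and loops. The value n = 0
    is left out because 0 to a nonzero exponent is 0. *)
Definition grows T E : Prop :=
  exists2 C : R, 0 <= C & forall n, (0 < n)%N -> (T n)%:R <= C * n%:R `^ E.

Lemma powR_ge1_mono (n : nat) E F : (0 < n)%N -> E <= F -> n%:R `^ E <= n%:R `^ F :> R.
Proof. by move=> n0 EF; apply: ler_powR => //; rewrite ler1n. Qed.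

Lemma growsW T E F : E <= F -> grows T E -> grows T F.
Proof.
move=> EF [C C0 TC]; exists C => // n n0; apply: le_trans (TC n n0) _.
by rewrite ler_wpM2l // powR_ge1_mono.
Qed.

Lemma growsD T T' E : grows T E -> grows T' E -> grows (fun n => T n + T' n)%N E.
Proof.
move=> [C C0 TC] [C' C'0 TC']; exists (C + C') => [|n n0]; first exact: addr_ge0.
by rewrite natrD mulrDl lerD ?TC ?TC'.
Qed.

Lemma growsM T T' E F : grows T E -> grows T' F -> grows (fun n => T n * T' n)%N (E + F).
Proof.
move=> [C C0 TC] [C' C'0 TC']; exists (C * C') => [|n n0]; first exact: mulr_ge0.
rewrite natrM powRD; last by rewrite pnatr_eq0 -lt0n n0 implybT.
by rewrite mulrACA ler_pM ?TC ?TC'.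
Qed.

Lemma grows_const c E : 0 <= E -> grows (fun=> c) E.
Proof.
move=> E0; apply: (growsW E0); exists c%:R => // n n0.
by rewrite powRr0 mulr1.
Qed.

Lemma grows_id : grows id 1.
Proof. by exists 1 => // n n0; rewrite mul1r powRr1. Qed.

Lemma grows_ltime l T E : 0 <= E -> grows T E -> grows (fun n => ltime n l (T n)) (l%:R + E).
Proof.
move=> E0 TE; elim: l => [|l IH] /=; first by rewrite add0r.
have lE : 0 <= l%:R + E by rewrite addr_ge0.
apply: growsD; first by apply: grows_const; rewrite addr_ge0.
rewrite -natr1 [l%:R + 1]addrC -addrA; apply: growsM; first exact: grows_id.
by apply: growsD => //; exact: grows_const.
Qed.

Lemma grows_mm (C w : R) m :
  grows (fun n => Num.truncn (`|C| * ((n ^ m)%:R `^ (w - 1) * (n ^ m)%:R))) (m%:R * w).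
Proof.
exists `|C| => // n n0; set y := `|C| * _.
have nm0 : (0 < n ^ m)%N by rewrite expn_gt0 n0.
have y0 : 0 <= y by rewrite !mulr_ge0 // powR_ge0.
apply: (le_trans (y := y)); first by rewrite truncn_le.
rewrite ler_wpM2l //.
rewrite -[X in _ * X]powRr1 // -powRD; last by rewrite pnatr_eq0 -lt0n nm0 implybT.
rewrite subrK natrX -powR_mulrn // -powRrM //.
Qed.

Definition bounded2 T E F : Prop :=
  exists2 C : R, 0 <= C & forall n, (0 < n)%N -> (T n)%:R <= C * (n%:R `^ E + n%:R `^ F).

Lemma bounded2l T E F : grows T E -> bounded2 T E F.
Proof.
move=> [C C0 TC]; exists C => // n n0; apply: le_trans (TC n n0) _.
by rewrite ler_wpM2l // lerDl powR_ge0.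
Qed.

Lemma bounded2r T E F : grows T F -> bounded2 T E F.
Proof.
move=> [C C0 TC]; exists C => // n n0; apply: le_trans (TC n n0) _.
by rewrite ler_wpM2l // lerDr powR_ge0.
Qed.

Lemma bounded2D T T' E F : bounded2 T E F -> bounded2 T' E F ->
  bounded2 (fun n => T n + T' n)%N E F.
Proof.
move=> [C C0 TC] [C' C'0 TC']; exists (C + C') => [|n n0]; first exact: addr_ge0.
by rewrite natrD mulrDl lerD ?TC ?TC'.
Qed.

Lemma grows_table_time l lp c :
  grows (fun n => table_time n l lp c) (l + lp)%:R.
Proof.
rewrite natrD; apply: grows_ltime => //.
have lp0 : 0 <= lp%:R :> R by [].
apply: growsD; last exact: grows_const.
apply: growsD; first exact: grows_const.
by rewrite -[X in grows _ X]addr0; apply: grows_ltime => //; exact: grows_const.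
Qed.

(** Filling the operands and reading the product takes about n^(2m) steps, which the multiplication
    dominates because w >= 2. *)
Lemma grows_block_time k (x : plan 'I_k) tm (w : R) : 2 <= w -> plan_ok x ->
  (forall m, grows (fun n => tm (n ^ m)%N) (m%:R * w)) ->
  grows (fun n => block_time x n tm) ((size (pl_A x))%:R * w).
Proof.
move=> w2 xok tmw; set m := size (pl_A x).
have mw0 : 0 <= m%:R * w by rewrite mulr_ge0 // (le_trans _ w2).
have [sB sC] := sizes_eq xok.
have lt2 c : grows (fun n => ltime n (m + m) c) (m%:R * w).
  apply: (growsW (E := (m + m)%:R + 0)).
    have : m%:R * 2 <= m%:R * w by rewrite ler_wpM2l.
    by rewrite addr0 natrD; lra.
  by apply: grows_ltime => //; exact: grows_const.
rewrite /block_time !size_cat sB sC -/m.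
do ![apply: growsD => //]; do ?[exact: grows_const].
Qed.

(** The tables are charged to [F], the outer loop around the matrix products to [E]. *)
Lemma bounded2_plan_time k (x : plan 'I_k) tm (w E F : R) p : 2 <= w -> plan_ok x ->
  plan_cheap x p ->
  (forall m, grows (fun n => tm (n ^ m)%N) (m%:R * w)) ->
  (size (pl_O x))%:R + (size (pl_A x))%:R * w <= E ->
  2 * p%:R + 2 + k%:R / 3 <= F ->
  bounded2 (fun n => plan_time x n tm) E F.
Proof.
move=> w2 xok [c1 c2 c3 _] tmw OE pF.
have mw0 : 0 <= (size (pl_A x))%:R * w by rewrite mulr_ge0 // (le_trans _ w2).
have OA0 : 0 <= (size (pl_O x))%:R + (size (pl_A x))%:R * w by rewrite addr_ge0.
have tab l lp c : (3 * (l + lp) <= 3 * (2 * p + 2) + k)%N ->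
    bounded2 (fun n => table_time n l lp c) E F.
  move=> le; apply: bounded2r; apply: growsW (grows_table_time l lp c).
  apply: le_trans pF; move: le; rewrite -(ler_nat R) !(natrM, natrD); lra.
rewrite card_ord in c1 c2 c3.
apply: bounded2D; first exact: tab.
apply: bounded2D; first exact: tab.
apply: bounded2D; first exact: tab.
apply: bounded2l; apply: growsW OE _.
apply: growsD; first exact: grows_const.
apply: grows_ltime => //; apply: growsD; last exact: grows_const.
exact: grows_block_time.
Qed.

End Growth.

(** * The exponent [tau] and the conclusion *)

Lemma tau_le (R : realType) : 2 <= omega R ->
  omega R < 2372 / 10 ^+ 3 + 863 / 10 ^+ 6 + 9 / 10 ^+ 7 ->
  3 / 10 < alpha R -> alpha R <= 3 - omega R -> tau R <= 1 / 18.
Proof.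
rewrite /tau; move: (omega R) (alpha R) => w a w2 wl al aw.
case: ifP => [a2|_]; last by lra.
(* After cross-multiplication the claim is 12(2-w)(1-2a) <= 0, true as w >= 2 and a <= 1/2. *)
have den : 0 < 36 - 6 * (1 + w) * (1 + a) by nra.
rewrite ler_pdivrMr //; nra.
Qed.

Lemma mem_le_sumn (s : seq nat) (x : nat) : x \in s -> (x <= sumn s)%N.
Proof.
elim: s => //= y s IH; rewrite inE => /orP[/eqP ->|/IH]; first exact: leq_addr.
by move=> le; apply: leq_trans le (leq_addl _ _).
Qed.

Theorem theorem3 (R : realType) :
  exists c : R, 0 <= c /\
  (2 <= omega R ->
   omega R < 2372 / 10 ^+ 3 + 863 / 10 ^+ 6 + 9 / 10 ^+ 7 ->
   3 / 10 < alpha R ->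
   alpha R <= 3 - omega R ->
   (alpha R = 1 <-> omega R = 2) ->
   mulmx_M1 R ->
   mulmx_M2 R ->
   forall (k p : nat) (P : sgraph 'I_k), is_pathwidth P p ->
   exists (prog : cmd) (T : nat -> nat),
     counts_in_time P prog T /\
     exists C : R, \forall n \near \oo,
       (T n)%:R <= C * (n%:R `^ ((1 / 2 - tau R) * k%:R + 2 * p%:R + c)
                        + n%:R `^ (k%:R / 3 + 3 * p%:R + c))).
Proof.
(* The constant pays for the 2 in the bound 2p+2 on the number of separating vertices. *)
exists 2; split=> // w2 wl al aw _ _ [mm [d [C M2]]] k p P pw.
have tau18 := tau_le w2 wl al aw.
have [part [part3 part0 parti parte]] := pathwidth_tripartition pw.
have [qs qsI qsE] := injectivity_expansion 'I_k.
pose pl q := quotient_plan P part q.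
(* Times are natural numbers, so the real bound may be truncated; the absolute value is there
   because nothing is known about the sign of [C]. *)
pose tm N := Num.truncn (`|C| * (N%:R `^ (omega R - 1) * N%:R)).
have mm_spec N : (0 < N)%N -> ram_mulmx mm d N N (fun t => (t <= tm N)%N).
  move=> N0 m A B Am Bm W s LW fs pre.
  have [t [s' [ex st le]]] := M2 N N N0 (leqnn N) m A B Am Bm W s LW fs pre.
  exists t, s'; split=> //; rewrite /tm.
  have y0 : 0 <= N%:R `^ (omega R - 1) * N%:R :> R by rewrite mulr_ge0 // powR_ge0.
  rewrite truncn_ge_nat; last by rewrite mulr_ge0.
  by apply: (le_trans le); rewrite ler_wpM2r // ler_norm.
(* Larger than every register and array that [mm] writes, and than the names 0, 1, 2 that its
   specification uses. *)
pose K := (sumn (wregs mm) + sumn (warrs mm)).+3.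
have mm_regs : {in wregs mm, forall r, (r < K)%N}.
  by move=> r /mem_le_sumn; rewrite /K; lia.
have mm_arrs : {in warrs mm, forall a, (a < K)%N}.
  by move=> r /mem_le_sumn; rewrite /K; lia.
have qs_ok x : x \in qs -> plan_ok (pl x.2).
  by move=> /(allP qsI) xI; exact: quotient_plan_ok part3 _ xI.
have qs_val n (H : sgraph 'I_n) x (e : {ffun 'I_k -> 'I_n}) : x \in qs ->
    plan_value (pl x.2) H e =
    \sum_(f : {ffun 'I_k -> 'I_n} | respects x.2 f) (is_hom P H f)%:R.
  by move=> /(allP qsI) xI; rewrite (quotient_plan_value part3 parte xI H e).
exists (count_prog K mm pl qs #|automorphisms P|), (count_time tm pl qs); split.
  apply: (count_prog_correct _ mm_regs mm_arrs mm_spec) => //.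
  - by move=> n H x xqs f g; rewrite !qs_val.
  - move=> n H e; rewrite natz -natz (embeddings_expansion P H (fun f => qsE _ f)).
    by rewrite big_seq [RHS]big_seq; apply: eq_bigr => x xqs; rewrite qs_val.
set E := _ + 2; set F := _ + 2.
suff [C' C'0 TC'] : bounded2 (count_time tm pl qs) E F.
  by exists C', 1%N => // n /= n1; exact: TC'.
have p0 : 0 <= p%:R :> R by [].
have k0 : 0 <= k%:R :> R by [].
(* This pays for copying the adjacency matrix. *)
have F2 : 2 <= F by rewrite /F; lra.
have tmw m : grows (fun n => tm (n ^ m)%N) (m%:R * omega R) by exact: grows_mm.
have cst c : bounded2 (fun=> c) E F by apply/bounded2r/grows_const; lra.
have plan_b x : x \in qs -> bounded2 (fun n => plan_time (pl x.2) n tm) E F.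
  move=> xqs; have := qs_ok x xqs; have xI := allP qsI x xqs.
  have cheap := quotient_plan_cheap P part3 xI part0 parti; rewrite -/(pl _) in cheap.
  move=> xok; apply: (bounded2_plan_time w2 xok cheap tmw).
    case: cheap => _ _ _; rewrite card_ord -(ler_nat R) !(natrM, natrD).
    move: (size _)%:R (size _)%:R (ler0n R (size (pl_A (pl x.2)))) => O A A0 le.
    (* The plan was balanced for 8/3, which exceeds omega; the resulting 4k/9 equals (1/2 - 1/18)k
       and tau is at most 1/18. *)
    have Aw : A * omega R <= A * (8 / 3) by rewrite ler_wpM2l //; lra.
    have tk : (1 / 2 - 1 / 18) * k%:R <= (1 / 2 - tau R) * k%:R by rewrite ler_wpM2r //; lra.
    rewrite /E; lra.
  rewrite /F; lra.
have sum_b qs' : {subset qs' <= qs} -> bounded2 (fun n => sum_time tm pl n qs') E F.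
  elim: qs' => [|x qs' IH] sub /=; first exact: cst.
  apply: bounded2D; first by apply: plan_b; apply: sub; rewrite mem_head.
  by apply: bounded2D => //; apply: IH => y yq; apply: sub; rewrite inE yq orbT.
rewrite /count_time.
have nn : bounded2 (fun n => n * n * 4)%N E F.
  apply: bounded2r; apply: (growsW F2).
  have -> : 2 = 1 + 1 + 0 :> R by lra.
  by apply: growsM (grows_const _ _) => //; apply: growsM; exact: grows_id.
by do !apply: bounded2D => //; exact: sum_b.
Qed.
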